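(* Partitioned Tensor Isomorphism of $n\times m\times\ell$ 3-tensors with $N\times M\times L$ many blocks reduces (by a polynomial-time computable map, such that the inputs are partitioned-isomorphic if and only if the outputs are isomorphic as plain 3-tensors) to Tensor Isomorphism for 3-tensors of size $n'''\times m'''\times\ell'''$ where $n'''=n(2^N+2^{N+M+L})+m(N+2^{M+L})+\ell 2^L+2^N-2+M+2^{N+M+L}+N2^L$, $m'''=n2^{N+M}+m2^M+\ell M-1+NM+2^{N+M}+L$, $\ell'''=n(L2^N+2^{N+M+L})+m(NL+2^{M+L})+\ell(2^L-1)-1+(2^N-1)L+ML+2^{N+M+L}+N2^L$. In particular, for $N,M,L=O(1)$ this is linear in the size of the original tensor.
   Context: Partitioned Tensor Isomorphism over a field $\mathbb{F}$: given $\mathtt{A},\mathtt{B}\in\mathrm{T}(n\times m\times\ell,\mathbb{F})$ and positive integers $n_1,\dots,n_N$, $m_1,\dots,m_M$, $\ell_1,\dots,\ell_L$ summing to $n,m,\ell$ respectively, decide whether there are $P_I\in\mathrm{GL}_{n_I}(\mathbb{F})$, $Q_J\in\mathrm{GL}_{m_J}(\mathbb{F})$, $R_K\in\mathrm{GL}_{\ell_K}(\mathbb{F})$ such that $(P_1\oplus\dots\oplus P_N,Q_1\oplus\dots\oplus Q_M,R_1\oplus\dots\oplus R_L)$ sends $\mathtt{A}$ to $\mathtt{B}$, where $(P,Q,R)$ acts by $a'_{i,j,k}=\sum P_{i,i'}Q_{j,j'}R_{k,k'}a_{i',j',k'}$. Tensor Isomorphism is the same with $N=M=L=1$.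
   Formalization: Since the output dimensions grow like 2^(N+M+L), ''polynomial-time'' is taken as time polynomial in the input size and 2^(N+M+L); this is polynomial in the input size for N, M, L = O(1), and no better is possible for unbounded numbers of blocks. *)

(* Defs.v *)
From HB Require Import structures.
From mathcomp Require Import all_boot all_order all_algebra.

Set Implicit Arguments.
Unset Strict Implicit.
Unset Printing Implicit Defensive.

Import GRing.Theory.
Local Open Scope ring_scope.

(** * Tensors and (partitioned) tensor isomorphism *)

Definition tensor (F : fieldType) (n m l : nat) : Type :=
  {ffun 'I_n * 'I_m * 'I_l -> F}.

Definition tensor_act (F : fieldType) (n m l : nat)
    (P : 'M[F]_n) (Q : 'M[F]_m) (R : 'M[F]_l) (A : tensor F n m l) :
    tensor F n m l :=
  [ffun t : 'I_n * 'I_m * 'I_l => let: (i, j, k) := t in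
     \sum_(i' < n) \sum_(j' < m) \sum_(k' < l)
       P i i' * Q j j' * R k k' * A (i', j', k')].

Definition tensor_iso (F : fieldType) (n m l : nat) (A B : tensor F n m l) :=
  exists (P : 'M[F]_n) (Q : 'M[F]_m) (R : 'M[F]_l),
    [/\ P \in unitmx, Q \in unitmx, R \in unitmx & tensor_act P Q R A = B].

Definition part_tensor_iso (F : fieldType) (N M L : nat)
    (p : 'I_N -> nat) (q : 'I_M -> nat) (r : 'I_L -> nat)
    (A B : tensor F (\sum_i p i) (\sum_j q j) (\sum_k r k)) :=
  exists (P : forall i : 'I_N, 'M[F]_(p i))
         (Q : forall j : 'I_M, 'M[F]_(q j))
         (R : forall k : 'I_L, 'M[F]_(r k)),
    [/\ forall i, P i \in unitmx,
        forall j, Q j \in unitmx,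
        forall k, R k \in unitmx
      & tensor_act (\mxdiag_i P i) (\mxdiag_j Q j) (\mxdiag_k R k) A = B].

(** * Target dimensions *)

(* The negative constants come last, so that the truncated subtractions are
   exact, also for N = M = L = 0. *)

Definition dim1 (N M L n m l : nat) : nat :=
  (n * (2 ^ N + 2 ^ (N + M + L)) + m * (N + 2 ^ (M + L)) + l * 2 ^ L
   + 2 ^ N + M + 2 ^ (N + M + L) + N * 2 ^ L - 2)%N.

Definition dim2 (N M L n m l : nat) : nat :=
  (n * 2 ^ (N + M) + m * 2 ^ M + l * M
   + N * M + 2 ^ (N + M) + L - 1)%N.

Definition dim3 (N M L n m l : nat) : nat :=
  (n * (L * 2 ^ N + 2 ^ (N + M + L)) + m * (N * L + 2 ^ (M + L))
   + l * (2 ^ L - 1)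
   + (2 ^ N - 1) * L + M * L + 2 ^ (N + M + L) + N * 2 ^ L - 1)%N.

(** * A random access machine over a field *)

(* Programs act on natural-number registers, an array [imem] of natural numbers
   and an array [fmem] of field elements, both with indirect addressing.
   Natural numbers are charged by their bit length. Field elements are charged
   [1 + sz x], where [sz : F -> nat] is a parameter: [sz = 0] is the
   unit-cost (arithmetic, Blum-Shub-Smale) model over [F], while for [F] finite
   or the rationals with [sz] the bit length, the cost is polynomially related
   to Turing machine time. *)

Inductive iexp : Type :=
| IConst of nat
| IReg of nat
| ILoad of iexp
| IAdd of iexp & iexp
| ISub of iexp & iexp
| IMul of iexp & iexp
| IDiv of iexp & iexp
| IMod of iexp & iexp.

Inductive fexp (F : Type) : Type :=
| FConst of F
| FLoad of iexp
| FAdd of fexp F & fexp F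
| FOpp of fexp F
| FMul of fexp F & fexp F
| FInv of fexp F.

Inductive bexp (F : Type) : Type :=
| BIle of iexp & iexp
| BIeq of iexp & iexp
| BFeq of fexp F & fexp F
| BNot of bexp F
| BAnd of bexp F & bexp F.

Inductive cmd (F : Type) : Type :=
| Skip
| SetReg of nat & iexp
| IStore of iexp & iexp
| FStore of iexp & fexp F
| Seq of cmd F & cmd F
| If of bexp F & cmd F & cmd F
| While of bexp F & cmd F.
Arguments Skip {F}.
Arguments SetReg {F}.
Arguments IStore {F}.

Record state (F : Type) : Type := State {
  reg : nat -> nat;
  imem : nat -> nat;
  fmem : nat -> F
}.

Definition bits (n : nat) : nat := (trunc_log 2 n).+1.

Section Semantics.
Variables (F : fieldType) (sz : F -> nat).
Implicit Types (s : state F).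

Fixpoint ieval s (e : iexp) : nat :=
  match e with
  | IConst n => n
  | IReg x => reg s x
  | ILoad e => imem s (ieval s e)
  | IAdd e1 e2 => (ieval s e1 + ieval s e2)%N
  | ISub e1 e2 => (ieval s e1 - ieval s e2)%N
  | IMul e1 e2 => (ieval s e1 * ieval s e2)%N
  | IDiv e1 e2 => (ieval s e1 %/ ieval s e2)%N
  | IMod e1 e2 => (ieval s e1 %% ieval s e2)%N
  end.

Fixpoint icost s (e : iexp) : nat :=
  (bits (ieval s e) +
   match e with
   | IConst _ | IReg _ => 0
   | ILoad e => icost s e
   | IAdd e1 e2 | ISub e1 e2 | IMul e1 e2 | IDiv e1 e2 | IMod e1 e2 =>
       icost s e1 + icost s e2
   end)%N.

Fixpoint feval s (e : fexp F) : F :=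
  match e with
  | FConst c => c
  | FLoad e => fmem s (ieval s e)
  | FAdd e1 e2 => feval s e1 + feval s e2
  | FOpp e => - feval s e
  | FMul e1 e2 => feval s e1 * feval s e2
  | FInv e => (feval s e)^-1
  end.

Fixpoint fcost s (e : fexp F) : nat :=
  ((sz (feval s e)).+1 +
   match e with
   | FConst _ => 0
   | FLoad e => icost s e
   | FOpp e | FInv e => fcost s e
   | FAdd e1 e2 | FMul e1 e2 => fcost s e1 + fcost s e2
   end)%N.

Fixpoint beval s (b : bexp F) : bool :=
  match b with
  | BIle e1 e2 => (ieval s e1 <= ieval s e2)%N
  | BIeq e1 e2 => ieval s e1 == ieval s e2
  | BFeq e1 e2 => feval s e1 == feval s e2
  | BNot b => ~~ beval s b
  | BAnd b1 b2 => beval s b1 && beval s b2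
  end.

Fixpoint bcost s (b : bexp F) : nat :=
  (1 + match b with
       | BIle e1 e2 | BIeq e1 e2 => icost s e1 + icost s e2
       | BFeq e1 e2 => fcost s e1 + fcost s e2
       | BNot b => bcost s b
       | BAnd b1 b2 => bcost s b1 + bcost s b2
       end)%N.

Definition set_reg s x v := State [eta reg s with x |-> v] (imem s) (fmem s).
Definition set_imem s a v := State (reg s) [eta imem s with a |-> v] (fmem s).
Definition set_fmem s a v := State (reg s) (imem s) [eta fmem s with a |-> v].

(* [exec c s s' t]: started in [s], [c] halts in [s'] after time [t]. *)
Inductive exec : cmd F -> state F -> state F -> nat -> Prop :=
| ExecSkip s : exec Skip s s 1
| ExecSetReg s x e :
    exec (SetReg x e) s (set_reg s x (ieval s e)) (icost s e).+1
| ExecIStore s a e :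
    exec (IStore a e) s (set_imem s (ieval s a) (ieval s e))
      (icost s a + icost s e).+1
| ExecFStore s a e :
    exec (FStore a e) s (set_fmem s (ieval s a) (feval s e))
      (icost s a + fcost s e).+1
| ExecSeq c1 c2 s s' s'' t1 t2 :
    exec c1 s s' t1 -> exec c2 s' s'' t2 ->
    exec (Seq c1 c2) s s'' (t1 + t2).+1
| ExecIf b c1 c2 s s' t :
    exec (if beval s b then c1 else c2) s s' t ->
    exec (If b c1 c2) s s' (bcost s b + t).+1
| ExecWhileStop b c s :
    ~~ beval s b -> exec (While b c) s s (bcost s b).+1
| ExecWhileStep b c s s' s'' t1 t2 :
    beval s b -> exec c s s' t1 -> exec (While b c) s' s'' t2 ->
    exec (While b c) s s'' (bcost s b + t1 + t2).+1.

End Semantics.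

(** * Polynomial-time maps from block-partitioned tensors to tensors *)

(* The entries in lexicographic order of the index triples. *)
Definition entries (F : fieldType) (n m l : nat) (A : tensor F n m l) : seq F :=
  [seq A (ij, k) | ij <- [seq (i, j) | i <- enum 'I_n, j <- enum 'I_m],
                   k <- enum 'I_l].

Definition block_sizes (N : nat) (p : 'I_N -> nat) : seq nat :=
  [seq p i | i <- enum 'I_N].

Definition input_state (F : fieldType) (N M L : nat)
    (p : 'I_N -> nat) (q : 'I_M -> nat) (r : 'I_L -> nat)
    (A : tensor F (\sum_i p i) (\sum_j q j) (\sum_k r k)) : state F :=
  State (nth 0%N [:: N; M; L])
        (nth 0%N (block_sizes p ++ block_sizes q ++ block_sizes r))
        (nth 0 (entries A)).

Definition outputs (F : fieldType) (n m l : nat)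
    (s : state F) (B : tensor F n m l) : Prop :=
  [/\ reg s 0 = n, reg s 1 = m, reg s 2 = l
    & mkseq (fmem s) (n * m * l) = entries B].

Definition tensor_size (F : fieldType) (sz : F -> nat) (n m l : nat)
    (A : tensor F n m l) : nat :=
  (n + m + l + \sum_t (sz (A t)).+1)%N.

Definition block_map (F : fieldType) : Type :=
  forall (N M L : nat) (p : 'I_N -> nat) (q : 'I_M -> nat) (r : 'I_L -> nat),
    let n := (\sum_i p i)%N in
    let m := (\sum_j q j)%N in
    let l := (\sum_k r k)%N in
    tensor F n m l ->
    tensor F (dim1 N M L n m l) (dim2 N M L n m l) (dim3 N M L n m l).

(* The output dimensions grow like 2 ^ (N + M + L), so the running time cannot
   be polynomial in the input size alone when the numbers of blocks are
   unbounded. It is required to be polynomial in the input size and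
   2 ^ (N + M + L), hence polynomial in the input size for bounded N, M, L. *)
Definition poly_time (F : fieldType) (f : block_map F) : Prop :=
  exists c : cmd F, forall sz : F -> nat, exists a d : nat,
    forall (N M L : nat) (p : 'I_N -> nat) (q : 'I_M -> nat) (r : 'I_L -> nat)
      (A : tensor F (\sum_i p i) (\sum_j q j) (\sum_k r k)),
      (forall i, 0 < p i)%N -> (forall j, 0 < q j)%N -> (forall k, 0 < r k)%N ->
      exists (s : state F) (t : nat),
        [/\ exec sz c (input_state A) s t, outputs s (f N M L p q r A)
          & (t <= a * (tensor_size sz A + 2 ^ (N + M + L)) ^ d)%N].

(* Main.v *)
Require Import Defs.
From HB Require Import structures.
From mathcomp Require Import all_boot all_order all_algebra.
From mathcomp Require Import zify ring.

Set Implicit Arguments.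
Unset Strict Implicit.
Unset Printing Implicit Defensive.

Import GRing.Theory.
Local Open Scope ring_scope.

(** Write [U], [V], [W] for the three coordinate spaces, with blocks [U_a],
    [V_b], [W_c]. Pad each block with new coordinates so that the padded block
    of index [a] in [U], [b] in [V], [c] in [W] has dimension [n + a + 1],
    [n + m + N + b + 1], [l + N + M + c + 1]. For every [a] add one new 3-slice
    [z_a] which is an identity matrix pairing the padded [U_a] with fresh
    coordinates of direction 2; for every [b] a 3-slice [z'_b] pairing the
    padded [V_b] with fresh coordinates of direction 1; for every [c] a 2-slice
    [y_c] pairing the padded [W_c] with fresh coordinates of direction 1. The
    rest of the output format is zero.

    A block-diagonal isomorphism extends by acting contragrediently on the fresh
    coordinates. Conversely, let [(P, Q, R)] be an isomorphism between two such
    tensors. All 2-slices other than the [y_c] have rank at most [l + N + M],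
    while the [y_c] have larger, pairwise distinct ranks; hence [Q] maps the span
    of the other slices to itself and is diagonal on the [y_c] modulo that span.
    Once the [y_c] are discarded the same holds for the 3-slices, whose rank is
    at most [n] apart from the [z_a] and [z'_b]. Since the identity pairings are
    then preserved up to nonzero scalars, [P], [Q], [R] preserve every padded
    block, and their compressions to [U], [V], [W] are block diagonal and carry
    one original tensor to the other. The compressions may be singular, but they
    exist in both directions, and then a comparison of the ranks of the
    flattenings, block by block, turns them into invertible ones. *)

(** * Tensor action and block-diagonal restrictions *)

Section TensorAction.
Variable F : fieldType.

Lemma sum_pairs (n m l : nat) (G : 'I_n -> 'I_m -> 'I_l -> F) :
  \sum_i \sum_j \sum_k G i j k = \sum_(t : 'I_n * 'I_m * 'I_l) G t.1.1 t.1.2 t.2.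
Proof. by rewrite pair_bigA pair_bigA. Qed.

Lemma sum_mul3 (n m l : nat) (f : 'I_n -> F) (g : 'I_m -> F) (h : 'I_l -> F) :
  \sum_(t : 'I_n * 'I_m * 'I_l) f t.1.1 * g t.1.2 * h t.2 =
  (\sum_i f i) * (\sum_j g j) * (\sum_k h k).
Proof.
rewrite -(sum_pairs (fun i j k => f i * g j * h k)).
rewrite -mulrA mulr_suml; apply: eq_bigr => i _.
rewrite mulr_suml mulr_sumr; apply: eq_bigr => j _.
by rewrite !mulr_sumr; apply: eq_bigr => k _; rewrite mulrA.
Qed.

Lemma tensor_actE (n m l : nat) (P : 'M[F]_n) (Q : 'M_m) (R : 'M_l)
    (A : tensor F n m l) s :
  tensor_act P Q R A s =
  \sum_t P s.1.1 t.1.1 * Q s.1.2 t.1.2 * R s.2 t.2 * A t.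
Proof.
case: s => [[i j] k]; rewrite ffunE (sum_pairs (fun i' j' k' => P i i' * Q j j' * R k k' * A (i', j', k'))).
by apply: eq_bigr => [[[]]].
Qed.

Lemma tensor_act_comp (n m l : nat) (P P' : 'M[F]_n) (Q Q' : 'M_m) (R R' : 'M_l)
    (A : tensor F n m l) :
  tensor_act P Q R (tensor_act P' Q' R' A) =
  tensor_act (P *m P') (Q *m Q') (R *m R') A.
Proof.
apply/ffunP => [[[i j] k]]; rewrite !tensor_actE.
under eq_bigr do rewrite tensor_actE mulr_sumr.
rewrite exchange_big; apply: eq_bigr => t _ /=.
rewrite !mxE -sum_mul3 mulr_suml; apply: eq_bigr => [[[a b] c]] _ /=; ring.
Qed.

Lemma tensor_act1 (n m l : nat) (A : tensor F n m l) :
  tensor_act 1%:M 1%:M 1%:M A = A.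
Proof.
apply/ffunP => [[[i j] k]]; rewrite tensor_actE (bigD1 (i, j, k)) //=.
rewrite !mxE !eqxx !mul1r big1 ?addr0 // => [[[a b] c]] /= ne.
rewrite !mxE; case: (eqVneq i a) (eqVneq j b) (eqVneq k c) ne =>
  [->|_] [->|_] [->|_]; rewrite ?eqxx //= ?mulr0n ?mulr0 ?mul0r //.
Qed.

Lemma tensor_iso_refl (n m l : nat) (A : tensor F n m l) : tensor_iso A A.
Proof. by exists 1%:M, 1%:M, 1%:M; rewrite !unitmx1 tensor_act1. Qed.

Lemma tensor_iso_sym (n m l : nat) (A B : tensor F n m l) :
  tensor_iso A B -> tensor_iso B A.
Proof.
case=> [P [Q [R [uP uQ uR <-]]]]; exists (invmx P), (invmx Q), (invmx R).
by rewrite !unitmx_inv uP uQ uR tensor_act_comp !mulVmx // tensor_act1.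
Qed.

(** Cyclic rotation of the directions: it carries statements proved for direction 1 over to
    directions 2 and 3. *)
Definition tensor_rot (n m l : nat) (A : tensor F n m l) : tensor F m l n :=
  [ffun t => A (t.2, t.1.1, t.1.2)].

Lemma tensor_act_rot (n m l : nat) (P : 'M[F]_n) (Q : 'M_m) (R : 'M_l)
    (A : tensor F n m l) :
  tensor_rot (tensor_act P Q R A) = tensor_act Q R P (tensor_rot A).
Proof.
apply/ffunP => [[[j k] i]]; rewrite ffunE !tensor_actE /=.
rewrite (reindex (fun t : 'I_m * 'I_l * 'I_n => (t.2, t.1.1, t.1.2))) /=.
  by apply: eq_bigr => [[[b c] a]] _; rewrite ffunE /=; ring.
by exists (fun t => (t.1.2, t.2, t.1.1)) => [] [[]].
Qed.

Lemma tensor_rot_inj (n m l : nat) : injective (@tensor_rot n m l).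
Proof.
move=> A B /ffunP e; apply/ffunP => [[[i j] k]].
by have := e (j, k, i); rewrite !ffunE.
Qed.

End TensorAction.

(** * Block-diagonal matrices and flattenings *)

Section BlockDiagonal.
Variables (F : fieldType) (N : nat) (p : 'I_N -> nat).

(** [tagnat.sig1 u] is the block that contains the coordinate [u]. Singular blocks are allowed. *)
Definition block_diag (P : 'M[F]_(\sum_i p i)) :=
  forall u v, tagnat.sig1 u != tagnat.sig1 v -> P u v = 0.

Lemma block_diag_mxdiag (P : forall i, 'M[F]_(p i)) : block_diag (\mxdiag_i P i).
Proof. by move=> u v /negbTE ne; rewrite !mxE ne mxE. Qed.

Lemma mxdiag_submxblock (P : 'M[F]_(\sum_i p i)) :
  block_diag P -> \mxdiag_i submxblock P i i = P.
Proof.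
move=> bP; apply/mxblockP => i j; rewrite /mxdiag mxblockK.
case: eqVneq => [<-|ne]; first by rewrite conform_mx_id.
by apply/matrixP => x y; rewrite !mxE bP // !tagnat.Rank1K.
Qed.

Lemma mxdiag_unit (P : forall i, 'M[F]_(p i)) :
  (forall i, P i \in unitmx) -> \mxdiag_i P i \in unitmx.
Proof.
move=> uP; have /mulmx1_unit[] // :
  \mxdiag_i P i *m \mxdiag_i invmx (P i) = 1%:M.
rewrite mul_mxdiag_mxblock -[RHS](mxdiagZ (p_ := p) 1).
apply/eq_mxblock => i j; case: eqVneq => [<-|_]; last by rewrite mulmx0.
by rewrite !conform_mx_id mulmxV.
Qed.

Section Flattening.
Variables (n m l : nat).

Definition tensor_flat (A : tensor F n m l) : 'M[F]_(n, #|{: 'I_m * 'I_l}|) :=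
  \matrix_(i, x) A (i, (enum_val x).1, (enum_val x).2).

Lemma tensor_flat_inj : injective tensor_flat.
Proof.
move=> A B /matrixP e; apply/ffunP => [[[i j] k]].
by have := e i (enum_rank (j, k)); rewrite !mxE enum_rankK.
Qed.

Lemma tensor_flat_act (P : 'M[F]_n) (Q : 'M_m) (R : 'M_l) (A : tensor F n m l) :
  tensor_flat (tensor_act P Q R A) = P *m tensor_flat A *m
    \matrix_(x, y) (Q (enum_val y).1 (enum_val x).1 *
                    R (enum_val y).2 (enum_val x).2).
Proof.
apply/matrixP => i y; rewrite !mxE ffunE /=.
under [RHS]eq_bigr do rewrite mxE mulr_suml.
rewrite [RHS]exchange_big /=; apply: eq_bigr => i' _; rewrite pair_bigA /=.
rewrite (reindex (@enum_val {: 'I_m * 'I_l} predT)) /=; last first.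
  by apply: onW_bij; exists enum_rank; [apply: enum_valK | apply: enum_rankK].
by apply: eq_bigr => x _; rewrite !mxE; ring.
Qed.
End Flattening.

(* An equality of row spaces lets the possibly singular block [P a] be replaced
   by an invertible one without changing its action on [A]. *)
Lemma invertible_blocks (m l : nat) (P P' : 'M[F]_(\sum_i p i)) (Q Q' : 'M_m)
    (R R' : 'M_l) (A B : tensor F (\sum_i p i) m l) :
  block_diag P -> block_diag P' ->
  tensor_act P Q R A = B -> tensor_act P' Q' R' B = A ->
  exists2 U : forall i, 'M[F]_(p i), (forall i, U i \in unitmx) &
    tensor_act (\mxdiag_i U i) Q R A = B.
Proof.
move=> bP bP' defB defA.
pose rows (C : tensor F (\sum_i p i) m l) a := submxcol (tensor_flat C) a.
(* The rows of block [a] in the flattening are multiplied by the diagonal block of [X] on the left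
   and by a Kronecker product on the right; the latter cannot raise the rank. *)
have rank_act X Y Z C a : block_diag X ->
    (\rank (rows (tensor_act X Y Z C) a) <= \rank (submxblock X a a *m rows C a))%N.
  move=> bX; rewrite /rows tensor_flat_act -{1}(mxdiag_submxblock bX).
  rewrite -{1}(submxcolK (tensor_flat C)) mul_mxdiag_mxcol.
  rewrite mxcol_mul mxcolK; exact: mxrankM_maxl.
have /fin_all_exists2[U uU eU] a : exists2 Ua, Ua \in unitmx &
    submxblock P a a *m rows A a = Ua *m rows A a.
  (* Matrices with equal row spaces differ by an invertible left factor. One inclusion is clear, and
     the ranks agree because rank A_a <= rank P'_a B_a <= rank B_a <= rank P_a A_a. *)
  apply/eqmxMunitP; rewrite -(mxrank_leqif_eq (submxMl _ _)) eqn_leq mxrankM_maxr /=.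
  rewrite -{1}defA (leq_trans (rank_act _ _ _ _ _ bP')) //.
  by rewrite (leq_trans (mxrankM_maxr _ _)) // -defB rank_act.
exists U => //; rewrite -defB; apply: tensor_flat_inj; rewrite !tensor_flat_act.
congr (_ *m _); rewrite -(mxdiag_submxblock bP) -(submxcolK (tensor_flat A)).
by rewrite !mul_mxdiag_mxcol; apply/eq_mxcol => a; rewrite -eU.
Qed.

End BlockDiagonal.

(** The preorder of restriction by block-diagonal, possibly singular matrices. *)
Definition part_restricts (F : fieldType) (N M L : nat)
    (p : 'I_N -> nat) (q : 'I_M -> nat) (r : 'I_L -> nat)
    (A B : tensor F (\sum_i p i) (\sum_j q j) (\sum_k r k)) :=
  exists P Q R, [/\ block_diag P, block_diag Q, block_diag R &
                   tensor_act P Q R A = B].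

(** The three directions are made invertible one after the other, with a rotation in between. [BA]
    only serves as the return map and may stay singular. *)
Lemma part_restricts_antisym (F : fieldType) (N M L : nat)
    (p : 'I_N -> nat) (q : 'I_M -> nat) (r : 'I_L -> nat)
    (A B : tensor F (\sum_i p i) (\sum_j q j) (\sum_k r k)) :
  part_restricts A B -> part_restricts B A -> part_tensor_iso A B.
Proof.
move=> [P [Q [R [bP bQ bR AB]]]] [P' [Q' [R' [bP' bQ' bR' BA]]]].
have [U uU {bP}AB] := invertible_blocks bP bP' AB BA.
have := congr1 (@tensor_rot _ _ _ _) AB; rewrite tensor_act_rot => {}AB.
have := congr1 (@tensor_rot _ _ _ _) BA; rewrite tensor_act_rot => {}BA.
have [V uV {bQ}AB] := invertible_blocks bQ bQ' AB BA.
have := congr1 (@tensor_rot _ _ _ _) AB; rewrite tensor_act_rot => {}AB.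
have := congr1 (@tensor_rot _ _ _ _) BA; rewrite tensor_act_rot => {}BA.
have [W uW {bR}AB] := invertible_blocks bR bR' AB BA.
exists U, V, W; split=> //.
by apply/tensor_rot_inj/tensor_rot_inj; rewrite !tensor_act_rot.
Qed.

(** * The gadget tensor *)

Section LinearAlgebra.
Variable F : fieldType.

Lemma sum_delta (T : finType) (f : T -> F) (x : T) :
  \sum_y f y * (y == x)%:R = f x.
Proof.
rewrite (bigD1 x) //= eqxx mulr1 big1 ?addr0 // => y /negbTE ->.
by rewrite mulr0.
Qed.

(** A rank bound: the hypothesis exhibits a diagonal matrix made of entries of P S Q^T, and only the
    rows of [S] in [I0] contribute to it. After scaling, an identity matrix with one row for each
    nonzero [d x] factors through [I0]. *)
Lemma card_diag_le_rows (a b s : nat) (P : 'M[F]_a) (Q : 'M[F]_b)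
    (S : 'I_a -> 'I_b -> F) (f : 'I_s -> 'I_a) (g : 'I_s -> 'I_b) (d : 'I_s -> F)
    (I0 : {set 'I_a}) :
  (forall x x', \sum_i \sum_j P (f x) i * Q (g x') j * S i j = d x * (x == x')%:R) ->
  (forall i j, i \notin I0 -> S i j = 0) ->
  (#|[set x | d x != 0%R]| <= #|I0|)%N.
Proof.
move=> diagS S0; pose D := [set x | d x != 0].
pose X := \matrix_(x < #|D|, i < #|I0|) ((d (enum_val x))^-1 * P (f (enum_val x)) (enum_val i)).
pose Y := \matrix_(i < #|I0|, x < #|D|) \sum_j Q (g (enum_val x)) j * S (enum_val i) j.
apply: (@mulmx1_min _ _ _ X Y); apply/matrixP => x y; rewrite !mxE.
under eq_bigr do rewrite !mxE -mulrA mulr_sumr.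
rewrite -mulr_sumr.
have <- : d (enum_val x) * (enum_val x == enum_val y)%:R =
    \sum_(i < #|I0|) \sum_j P (f (enum_val x)) (enum_val i) *
      (Q (g (enum_val y)) j * S (enum_val i) j).
  rewrite -diagS (bigID (mem I0)) /= [X in _ + X]big1 ?addr0 => [|i I0i]; last first.
    by apply: big1 => j _; rewrite S0 ?mulr0.
  by rewrite big_enum_val; do 2!apply: eq_bigr => ? _; rewrite mulrA.
have dx : d (enum_val x) != 0 by have := enum_valP x; rewrite inE.
by rewrite mulrA mulVf // mul1r (inj_eq enum_val_inj).
Qed.

(** The entry (z, z) of the product reduces to [Q z z * Q' z z], which must be 1. *)
Lemma diag_inv_neq0 (d : nat) (Q Q' : 'M[F]_d) z :
  Q *m Q' = 1%:M -> (forall k, k != z -> Q z k * Q' k z = 0) -> Q z z != 0.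
Proof.
move=> /matrixP/(_ z z); rewrite !mxE eqxx => QQ' off.
apply/eqP => Qzz; move: QQ'; rewrite (bigD1 z) //= Qzz mul0r add0r big1 //.
by move/eqP; rewrite eq_sym oner_eq0.
Qed.

(* Summing the hypothesis over [c] shows that [Pi] is invertible, so each colour
   class can be solved separately. *)
Lemma coloured_diag (s d C : nat) (col : 'I_s -> 'I_C) (e : 'I_s -> 'I_d)
    (Pi : 'I_s -> 'I_s -> F) (rho : 'I_d -> 'I_s -> F) (lam : 'I_C -> 'I_C -> F) :
  injective e ->
  (forall c x k, \sum_(y | col y == c) Pi x y * rho k y =
                 lam c (col x) * (k == e x)%:R) ->
  (forall c, lam c c != 0) -> (forall c c', c != c' -> lam c c' = 0) ->
  forall k y, (forall x, col x = col y -> k != e x) -> rho k y = 0.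
Proof.
move=> e_inj eqn lam_n0 lam0 k y ky.
have uPi : \matrix_(x, y) Pi x y \in unitmx.
  have /mulmx1_unit[] // : (\matrix_(x, y) Pi x y) *m
      (\matrix_(y, x) ((lam (col x) (col x))^-1 * rho (e x) y)) = 1%:M.
  apply/matrixP => x x'; rewrite !mxE.
  under eq_bigr do rewrite !mxE mulrCA.
  rewrite -mulr_sumr (partition_big col xpredT) //=.
  under eq_bigr do rewrite eqn.
  rewrite (bigD1 (col x)) //= big1 ?addr0 => [|c ne]; last by rewrite lam0 ?mul0r.
  rewrite (inj_eq e_inj) eq_sym; case: eqVneq => [->|_]; last by rewrite !mulr0.
  by rewrite mulr1 mulVf.
(* The row [k] of [rho] cut down to the colour of [y]. The matrix of [Pi] kills it: for [x] of
   another colour because [lam] vanishes, for [x] of the same colour because [k != e x]. *)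
pose v := \col_y' ((col y' == col y)%:R * rho k y').
suff /colP/(_ y) : v = 0 by rewrite !mxE eqxx mul1r.
rewrite -[v](mulKmx uPi); suff -> : (\matrix_(x, y) Pi x y) *m v = 0 by rewrite mulmx0.
apply/colP => x; rewrite !mxE.
transitivity (\sum_(y' | col y' == col y) Pi x y' * rho k y').
  rewrite [RHS]big_mkcond; apply: eq_bigr => y' _; rewrite !mxE.
  by case: eqP; rewrite ?mul1r // mul0r mulr0.
rewrite eqn; case: (eqVneq (col y) (col x)) => [yx|ne]; last by rewrite lam0 ?mul0r.
by rewrite (negbTE (ky x (esym yx))) mulr0.
Qed.

End LinearAlgebra.

(** * Extension of matrices by the identity, and invariance of pairings *)

Section Lift.
Variables (F : fieldType) (S : finType) (d : nat) (e : S -> 'I_d).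
Hypothesis e_inj : injective e.

(** Acts by [X] on the basis vectors in the image of [e] and fixes the others. *)
Definition lift_fun_mx (X : S -> S -> F) : 'M[F]_d :=
  \matrix_(i, k) if [pick s | k == e s] is Some s
                 then \sum_x X x s * (i == e x)%:R else (i == k)%:R.

Lemma lift_fun_mxE X i s : lift_fun_mx X i (e s) = \sum_x X x s * (i == e x)%:R.
Proof.
rewrite mxE; case: pickP => [s' /eqP/e_inj <- //|/(_ s)].
by rewrite eqxx.
Qed.

Lemma lift_fun_mx_off X i k : (forall s, k != e s) -> lift_fun_mx X i k = (i == k)%:R.
Proof.
by move=> ke; rewrite mxE; case: pickP => // s /eqP kE; have := ke s; rewrite kE eqxx.
Qed.

(** Lifts compose, so the lift of [X'] is inverse to the lift of [X]. *)
Lemma lift_fun_mx_unit X X' :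
  (forall x z, \sum_y X x y * X' y z = (x == z)%:R) -> lift_fun_mx X \in unitmx.
Proof.
move=> XX'; have /mulmx1_unit[] // : lift_fun_mx X *m lift_fun_mx X' = 1%:M.
apply/matrixP => i k; rewrite !mxE.
case: (pickP (fun s => k == e s)) => [s /eqP ->|ke]; last first.
  have koff s : k != e s by rewrite ke.
  under eq_bigr do rewrite [lift_fun_mx X' _ _]lift_fun_mx_off //.
  by rewrite sum_delta lift_fun_mx_off.
under eq_bigr do rewrite [lift_fun_mx X' _ _]lift_fun_mxE mulr_sumr.
rewrite exchange_big /=.
under eq_bigr => y _.
  under eq_bigr do rewrite mulrCA; rewrite -mulr_sumr sum_delta lift_fun_mxE mulr_sumr.
  over.
rewrite exchange_big /= -[RHS](sum_delta (fun x => (i == e x)%:R) s).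
apply: eq_bigr => x _; rewrite -XX' mulr_sumr.
by apply: eq_bigr => y _; rewrite mulrA mulrC [X' _ _ * _]mulrC.
Qed.

End Lift.

Section BlockFun.
Variables (F : fieldType) (a b c : nat).

Definition block3 (X : 'M[F]_a) (Y : 'M[F]_b) (Z : 'M[F]_c)
    (s t : 'I_a + 'I_b + 'I_c) : F :=
  match s, t with
  | inl (inl x), inl (inl y) => X x y
  | inl (inr x), inl (inr y) => Y x y
  | inr x, inr y => Z x y
  | _, _ => 0
  end.

Lemma sum_block3 (f : 'I_a + 'I_b + 'I_c -> F) :
  \sum_s f s = \sum_x f (inl (inl x)) + \sum_x f (inl (inr x)) + \sum_x f (inr x).
Proof. by rewrite big_sumType big_sumType. Qed.

Lemma block3_inv X X' Y Y' Z Z' :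
  X *m X' = 1%:M -> Y *m Y' = 1%:M -> Z *m Z' = 1%:M ->
  forall s t, \sum_u block3 X Y Z s u * block3 X' Y' Z' u t = (s == t)%:R.
Proof.
have mul0 (T : finType) (f : T -> F) : \sum_u 0 * f u = 0.
  by rewrite big1 // => u _; rewrite mul0r.
have mulr0 (T : finType) (f : T -> F) : \sum_u f u * 0 = 0.
  by rewrite big1 // => u _; rewrite mulr0.
move=> /matrixP XX' /matrixP YY' /matrixP ZZ' [[x|x]|x] [[y|y]|y];
  rewrite sum_block3 /= ?mul0 ?mulr0 ?add0r ?addr0 //.
- by have := XX' x y; rewrite !mxE.
- by have := YY' x y; rewrite !mxE.
- by have := ZZ' x y; rewrite !mxE.
Qed.

End BlockFun.

(** Invariance of a coloured identity pairing when one side is transformed by [U] and the other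
    contragrediently. The label [h (col y)] passes through because [U] does not mix colours. *)
Lemma contragredient_sum (F : fieldType) (s C : nat) (U U' : 'M[F]_s) (col : 'I_s -> 'I_C)
    (f g : 'I_s -> F) (h : 'I_C -> F) :
  U *m U' = 1%:M -> (forall x y, col x != col y -> U x y = 0) ->
  \sum_y (\sum_x U x y * f x) * (\sum_x U' y x * g x) * h (col y) =
  \sum_x f x * g x * h (col x).
Proof.
move=> /matrixP UU' colU.
transitivity (\sum_y \sum_x \sum_z (U x y * U' y z) * (f x * g z * h (col x))).
  apply: eq_bigr => y _; rewrite !mulr_suml; apply: eq_bigr => x _.
  rewrite mulr_sumr mulr_suml; apply: eq_bigr => z _.
  by case: (eqVneq (col x) (col y)) => [->|/colU ->]; ring.
rewrite exchange_big /=; apply: eq_bigr => x _; rewrite exchange_big /=.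
transitivity (\sum_z (f x * g z * h (col x)) * (z == x)%:R); last by rewrite sum_delta.
apply: eq_bigr => z _; rewrite -mulr_suml mulrC.
by have := UU' x z; rewrite !mxE eq_sym => ->.
Qed.

Lemma lift_colour (F : fieldType) (n s C : nat) (h : 'I_n -> 'I_s) (col : 'I_s -> 'I_C)
    (P : 'M[F]_n) :
  injective h -> (forall u u', col (h u) != col (h u') -> P u u' = 0) ->
  forall x y, col x != col y -> lift_fun_mx h P x y = 0.
Proof.
move=> h_inj colP x y ne; case: (pickP (fun u => y == h u)) => [u /eqP yE|off].
  rewrite yE lift_fun_mxE // big1 // => u' _; case: eqVneq => [xE|_]; last by rewrite mulr0.
  by rewrite colP ?mul0r // -xE -yE.
rewrite lift_fun_mx_off => [|u]; last by rewrite off.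
by case: (eqVneq x y) ne => [->|//]; rewrite eqxx.
Qed.

Lemma lift_fun_mx_inv (F : fieldType) (n s : nat) (h : 'I_n -> 'I_s) (P : 'M[F]_n) :
  injective h -> P \in unitmx -> lift_fun_mx h P \in unitmx.
Proof.
move=> h_inj uP; apply: (lift_fun_mx_unit h_inj (X' := invmx P)) => x z.
by have /matrixP/(_ x z) := mulmxV uP; rewrite !mxE.
Qed.

(** * The gadget and its entries *)

Section Gadget.
(** [nU], [mV], [lW] count the padded coordinates; [hU], [hV], [hW] embed the original coordinates
    among them, and [cU], [cV], [cW] give their blocks. The maps [e1], [e2], [e3] place everything
    in the output format; the concrete layout is kept abstract here. *)
Variables (F : fieldType) (d1 d2 d3 n m l nU mV lW N M L : nat).
Variables (e1 : 'I_nU + 'I_mV + 'I_lW -> 'I_d1) (e2 : 'I_mV + 'I_nU + 'I_L -> 'I_d2).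
Variable (e3 : 'I_lW + 'I_N + 'I_M -> 'I_d3).
Variables (hU : 'I_n -> 'I_nU) (hV : 'I_m -> 'I_mV) (hW : 'I_l -> 'I_lW).
Variables (cU : 'I_nU -> 'I_N) (cV : 'I_mV -> 'I_M) (cW : 'I_lW -> 'I_L).
Hypotheses (e1_inj : injective e1) (e2_inj : injective e2) (e3_inj : injective e3).
Hypotheses (hU_inj : injective hU) (hV_inj : injective hV) (hW_inj : injective hW).

(* [eU'], [eV'], [eW'] are the fresh coordinates paired with [eU], [eV], [eW];
   [yW], [zU], [zV] are the indices of the new slices. *)
Local Notation eU x := (e1 (inl (inl x))).
Local Notation eV' x := (e1 (inl (inr x))).
Local Notation eW' x := (e1 (inr x)).
Local Notation eV x := (e2 (inl (inl x))).
Local Notation eU' x := (e2 (inl (inr x))).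
Local Notation yW c := (e2 (inr c)).
Local Notation eW x := (e3 (inl (inl x))).
Local Notation zU a := (e3 (inl (inr a))).
Local Notation zV b := (e3 (inr b)).

Definition main_pos (t : 'I_n * 'I_m * 'I_l) : 'I_d1 * 'I_d2 * 'I_d3 :=
  (eU (hU t.1.1), eV (hV t.1.2), eW (hW t.2)).
Definition posU (x : 'I_nU) : 'I_d1 * 'I_d2 * 'I_d3 := (eU x, eU' x, zU (cU x)).
Definition posV (x : 'I_mV) : 'I_d1 * 'I_d2 * 'I_d3 := (eV' x, eV x, zV (cV x)).
Definition posW (x : 'I_lW) : 'I_d1 * 'I_d2 * 'I_d3 := (eW' x, yW (cW x), eW x).

Definition gadget (A : tensor F n m l) : tensor F d1 d2 d3 :=
  [ffun s => \sum_t A t * (s == main_pos t)%:R + \sum_x (s == posU x)%:R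
             + \sum_x (s == posV x)%:R + \sum_x (s == posW x)%:R].

Lemma act_gadget (P : 'M[F]_d1) (Q : 'M_d2) (R : 'M_d3) A s :
  let w (t : 'I_d1 * 'I_d2 * 'I_d3) := P s.1.1 t.1.1 * Q s.1.2 t.1.2 * R s.2 t.2 in
  tensor_act P Q R (gadget A) s =
  \sum_t A t * w (main_pos t) + \sum_x w (posU x) + \sum_x w (posV x)
  + \sum_x w (posW x).
Proof.
move=> w; rewrite tensor_actE.
under eq_bigr do rewrite -/(w _) ffunE !mulrDr !mulr_sumr.
rewrite !big_split /=; congr (_ + _ + _ + _); rewrite exchange_big /=;
  apply: eq_bigr => x _; rewrite ?sum_delta //.
by under eq_bigr do rewrite mulrCA; rewrite -mulr_sumr sum_delta.
Qed.

Variant gadget_case_spec (A : tensor F n m l) (s : 'I_d1 * 'I_d2 * 'I_d3) : Prop :=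
| GadgetMain t of s = main_pos t
| GadgetU x of s = posU x
| GadgetV x of s = posV x
| GadgetW x of s = posW x
| GadgetZero of gadget A s = 0.

Lemma gadgetP A s : gadget_case_spec A s.
Proof.
case: (pickP (fun t => s == main_pos t)) => [t /eqP|s0]; first exact: GadgetMain.
case: (pickP (fun x => s == posU x)) => [x /eqP|sU]; first exact: GadgetU.
case: (pickP (fun x => s == posV x)) => [x /eqP|sV]; first exact: GadgetV.
case: (pickP (fun x => s == posW x)) => [x /eqP|sW]; first exact: GadgetW.
apply: GadgetZero; rewrite ffunE !big1 ?addr0 // => x _;
  by rewrite ?s0 ?sU ?sV ?sW ?mulr0.
Qed.


(** * Ranks of the slices *)

Local Notation rU a := #|[set x | cU x == a]|.
Local Notation rV b := #|[set x | cV x == b]|.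
Local Notation rW c := #|[set x | cW x == c]|.

(** The padding makes the new slices exceed the ranks of the ordinary ones, at most [n] for 3-slices
    and [l + N + M] for 2-slices. The classes of [U] and of [V] both label 3-slices, so they are
    also separated from each other. *)
Hypotheses (rU_gt : forall a : 'I_N, (n < rU a)%N) (rW_gt : forall c : 'I_L, (l + N + M < rW c)%N).
Hypothesis rUV : forall (a : 'I_N) (b : 'I_M), (rU a < rV b)%N.
Hypothesis rU_mono : forall a a' : 'I_N, (a < a')%N -> (rU a < rU a')%N.
Hypothesis rV_mono : forall b b' : 'I_M, (b < b')%N -> (rV b < rV b')%N.
Hypothesis rW_mono : forall c c' : 'I_L, (c < c')%N -> (rW c < rW c')%N.

Lemma pair3_eq (T1 T2 T3 : eqType) (a a' : T1) (b b' : T2) (c c' : T3) :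
  ((a, b, c) == (a', b', c')) = [&& a == a', b == b' & c == c'].
Proof. by rewrite !xpair_eqE andbA. Qed.

Let inl_eq (S T : eqType) (x x' : S) : (inl x == inl x' :> S + T) = (x == x').
Proof. by []. Qed.
Let inr_eq (S T : eqType) (y y' : T) : (inr y == inr y' :> S + T) = (y == y').
Proof. by []. Qed.
Let inlr_eq (S T : eqType) (x : S) (y : T) : (inl x == inr y :> S + T) = false.
Proof. by []. Qed.
Let inrl_eq (S T : eqType) (x : S) (y : T) : (inr y == inl x :> S + T) = false.
Proof. by []. Qed.
Let sumE := (inj_eq e1_inj, inj_eq e2_inj, inj_eq e3_inj, inl_eq, inr_eq, inlr_eq, inrl_eq).


Ltac kill := rewrite ?mxE ?sumE /= ?mxE ?sumE /= ?(mulr0n, mulr0, mul0r) //.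

(** In the rows [eW'] only the pairings of [W] are nonzero. So the 2-slice [j] contains a diagonal
    block whose entries are the coefficients of [Q] at the new slices. The next two lemmas do the
    same for [R] and the 3-slices. *)
Lemma act_1Q1 Q A x j k :
  tensor_act 1%:M Q 1%:M (gadget A) (eW' x, j, k) = Q j (yW (cW x)) * (k == eW x)%:R.
Proof.
rewrite act_gadget /= [X in _ + _ + _ + X](bigD1 x) //= !big1 ?add0r ?addr0.
- by rewrite !mxE eqxx mul1r.
- by move=> y; rewrite eq_sym => /negbTE ne; rewrite !mxE !sumE ne !mul0r.
- by move=> y _; kill.
- by move=> y _; kill.
- by move=> y _; kill.
Qed.

Lemma act_11R_U R A x i k :
  tensor_act 1%:M 1%:M R (gadget A) (i, eU' x, k) = R k (zU (cU x)) * (i == eU x)%:R.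
Proof.
rewrite act_gadget /= [X in _ + X + _ + _](bigD1 x) //= !big1 ?add0r ?addr0.
- by rewrite !mxE eqxx mulr1 mulrC.
- by move=> y _; kill.
- by move=> y _; kill.
- by move=> y; rewrite eq_sym => /negbTE ne; rewrite !mxE !sumE ne mulr0 mul0r.
- by move=> y _; kill.
Qed.

Lemma act_11R_V R A x j k :
  tensor_act 1%:M 1%:M R (gadget A) (eV' x, j, k) = R k (zV (cV x)) * (j == eV x)%:R.
Proof.
rewrite act_gadget /= [X in _ + _ + X + _](bigD1 x) //= !big1 ?add0r ?addr0.
- by rewrite !mxE eqxx mul1r mulrC.
- by move=> y _; kill.
- by move=> y; rewrite eq_sym => /negbTE ne; rewrite !mxE !sumE ne !mul0r.
- by move=> y _; kill.
- by move=> y _; kill.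
Qed.

(** Together with the two lemmas that follow, this computes the other side of the isolated
    equations, in the form that [coloured_diag] requires. *)
Lemma act_P1R P R A i c k :
  tensor_act P 1%:M R (gadget A) (i, yW c, k) =
  \sum_(y | cW y == c) P i (eW' y) * R k (eW y).
Proof.
rewrite act_gadget /= [X in X + _ + _ + _]big1 ?[X in _ + X + _ + _]big1
  ?[X in _ + X + _]big1 ?add0r ?addr0; try by move=> y _; kill.
rewrite [RHS]big_mkcond; apply: eq_bigr => y _; rewrite !mxE !sumE /= eq_sym.
by case: eqP => _; rewrite /= ?(mulr1n, mulr0n, mulr1, mulr0, mul0r).
Qed.

Lemma act_PQ1_U P Q A i j a :
  tensor_act P Q 1%:M (gadget A) (i, j, zU a) =
  \sum_(y | cU y == a) P i (eU y) * Q j (eU' y).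
Proof.
rewrite act_gadget /= [X in X + _ + _ + _]big1 ?[X in _ + X + _]big1
  ?[X in _ + _ + X]big1 ?add0r ?addr0; try by move=> y _; kill.
rewrite [RHS]big_mkcond; apply: eq_bigr => y _; rewrite !mxE !sumE /= eq_sym.
by case: eqP => _; rewrite /= ?(mulr1n, mulr0n, mulr1, mulr0, mul0r).
Qed.

Lemma act_PQ1_V P Q A i j b :
  tensor_act P Q 1%:M (gadget A) (i, j, zV b) =
  \sum_(y | cV y == b) P i (eV' y) * Q j (eV y).
Proof.
rewrite act_gadget /= [X in X + _ + _ + _]big1 ?[X in _ + X + _ + _]big1
  ?[X in _ + _ + X]big1 ?add0r ?addr0; try by move=> y _; kill.
rewrite [RHS]big_mkcond; apply: eq_bigr => y _; rewrite !mxE !sumE /= eq_sym.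
by case: eqP => _; rewrite /= ?(mulr1n, mulr0n, mulr1, mulr0, mul0r).
Qed.

Lemma act_mid (P : 'M[F]_d1) (R : 'M_d3) (T : tensor F d1 d2 d3) i j k :
  tensor_act P 1%:M R T (i, j, k) =
  \sum_(k' < d3) \sum_(i' < d1) R k k' * P i i' * T (i', j, k').
Proof.
rewrite ffunE [RHS]exchange_big; apply: eq_bigr => i' _ /=.
rewrite (bigD1 j) //= [X in _ + X]big1 ?addr0 => [|j' /negbTE ne].
  by apply: eq_bigr => k' _; rewrite mxE eqxx mulr1 [P _ _ * _]mulrC.
by apply: big1 => k' _; rewrite mxE eq_sym ne mulr0 !mul0r.
Qed.

Lemma act_last (P : 'M[F]_d1) (Q : 'M_d2) (T : tensor F d1 d2 d3) i j k :
  tensor_act P Q 1%:M T (i, j, k) =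
  \sum_(i' < d1) \sum_(j' < d2) P i i' * Q j j' * T (i', j', k).
Proof.
rewrite ffunE; apply: eq_bigr => i' _ /=; apply: eq_bigr => j' _.
rewrite (bigD1 k) //= [X in _ + X]big1 ?addr0 => [|k' /negbTE ne].
  by rewrite mxE eqxx mulr1.
by rewrite mxE eq_sym ne mulr0 !mul0r.
Qed.

(** On the right, slice [j] has the diagonal block of [act_1Q1]; on the left it is slice [j] of
    [gadget B], supported on [K], multiplied by [P] and [R]. *)
Lemma count_W P Q R A B j (K : {set 'I_d3}) :
  tensor_act P 1%:M R (gadget B) = tensor_act 1%:M Q 1%:M (gadget A) ->
  (forall i k, k \notin K -> gadget B (i, j, k) = 0) ->
  (#|[set x | Q j (yW (cW x)) != 0%R]| <= #|K|)%N.
Proof.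
move=> /ffunP actE B0.
apply: (@card_diag_le_rows _ _ _ _ R P (fun k i => gadget B (i, j, k))
  (fun x => eW x) (fun x => eW' x) (fun x => Q j (yW (cW x)))) => [x x'|k i Kk]; last exact: B0.
rewrite -act_mid actE act_1Q1 !sumE; by case: eqVneq => [->|_]; rewrite ?mulr0.
Qed.

Definition offW j := [forall c, j != yW c].

(** Block lower triangularity, for the order that puts the ordinary 2-slices first, as one block,
    and then the [yW c] by increasing [c]. *)
Definition lowerW (Q : 'M[F]_d2) :=
  (forall j c, offW j -> Q j (yW c) = 0) /\
  (forall c c' : 'I_L, (c < c')%N -> Q (yW c) (yW c') = 0).

Section CountZ.
Variables (P : 'M[F]_d1) (Q : 'M[F]_d2) (R : 'M[F]_d3) (A B : tensor F n m l).
Variables (k : 'I_d3) (K : {set 'I_d1}).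
Hypothesis lowQ : lowerW Q.
Hypothesis actE : tensor_act P Q 1%:M (gadget B) = tensor_act 1%:M 1%:M R (gadget A).
Hypothesis B0 : forall i j, i \notin K -> offW j -> gadget B (i, j, k) = 0.

(** An ordinary row of [Q] vanishes in the columns [yW c], so the slices [yW c] of [gadget B] may be
    erased before the ranks of 3-slices are compared. *)
Lemma act_offW i j : offW j ->
  \sum_(i' < d1) \sum_(j' < d2) P i i' * Q j j' *
    (if offW j' then gadget B (i', j', k) else 0) =
  tensor_act 1%:M 1%:M R (gadget A) (i, j, k).
Proof.
move=> oj; rewrite -actE act_last; do 2!apply: eq_bigr => ? _.
case: ifPn => // /forallPn[c]; rewrite negbK => /eqP ->.
by rewrite lowQ.1 // !mulr0 mul0r.
Qed.

Lemma count_U : (#|[set x | R k (zU (cU x)) != 0%R]| <= #|K|)%N.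
Proof.
apply: (@card_diag_le_rows _ _ _ _ P Q
  (fun i j => if offW j then gadget B (i, j, k) else 0)
  (fun x => eU x) (fun x => eU' x) (fun x => R k (zU (cU x)))) => [x x'|i j Ki]; last first.
  by case: ifP => // oj; apply: B0.
rewrite act_offW; last by apply/forallP => c; rewrite !sumE.
rewrite act_11R_U !sumE; by case: eqVneq => [->|_]; rewrite ?mulr0.
Qed.

Lemma count_V : (#|[set x | R k (zV (cV x)) != 0%R]| <= #|K|)%N.
Proof.
apply: (@card_diag_le_rows _ _ _ _ P Q
  (fun i j => if offW j then gadget B (i, j, k) else 0)
  (fun x => eV' x) (fun x => eV x) (fun x => R k (zV (cV x)))) => [x x'|i j Ki]; last first.
  by case: ifP => // oj; apply: B0.
rewrite act_offW; last by apply/forallP => c; rewrite !sumE.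
rewrite act_11R_V !sumE eq_sym; by case: eqVneq => [->|_]; rewrite ?mulr0.
Qed.
End CountZ.

Lemma card_class_le (s C : nat) (col : 'I_s -> 'I_C) (f : 'I_C -> F) c :
  f c != 0 -> (#|[set x | col x == c]| <= #|[set x | f (col x) != 0%R]|)%N.
Proof.
by move=> fc; apply/subset_leq_card/subsetP => x; rewrite !inE => /eqP ->.
Qed.

Lemma card_classes_le (s C : nat) (col : 'I_s -> 'I_C) (f : 'I_C -> F) c c' :
  c != c' -> f c != 0 -> f c' != 0 ->
  (#|[set x | col x == c]| + #|[set x | col x == c']| <=
   #|[set x | f (col x) != 0%R]|)%N.
Proof.
move=> ne fc fc'; rewrite -cardsUI (_ : _ :&: _ = set0) ?cards0 ?addn0.
  by apply/subset_leq_card/subsetP => x; rewrite !inE => /orP[] /eqP ->.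
apply/setP => x; rewrite !inE; apply/negP => /andP[/eqP-> /eqP cc'].
by rewrite cc' eqxx in ne.
Qed.

(** Away from the new 2-slices, the third coordinate of a nonzero entry is an original coordinate of
    [W] or the index of a new 3-slice. *)
Lemma slice_offW A j : offW j -> exists2 K : {set 'I_d3}, (#|K| <= l + N + M)%N &
  forall i k, k \notin K -> gadget A (i, j, k) = 0.
Proof.
move=> /forallP oj.
exists ([set eW (hW w) | w in 'I_l] :|: [set zU a | a in 'I_N] :|: [set zV b | b in 'I_M]).
  apply: leq_trans (leq_card_setU _ _) _; apply: leq_add.
    apply: leq_trans (leq_card_setU _ _) _; apply: leq_add;
      by rewrite (leq_trans (leq_imset_card _ _)) ?card_ord.
  by rewrite (leq_trans (leq_imset_card _ _)) ?card_ord.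
move=> i k; rewrite !inE !negb_or => /andP[/andP[kW kU] kV].
case: (gadgetP A (i, j, k)) => [t|x|x|x|//] [_ jE kE].
- by case/negP: kW; rewrite kE imset_f.
- by case/negP: kU; rewrite kE imset_f.
- by case/negP: kV; rewrite kE imset_f.
- by have := oj (cW x); rewrite jE eqxx.
Qed.

Lemma slice_yW A c : exists2 K : {set 'I_d3}, (#|K| <= rW c)%N &
  forall i k, k \notin K -> gadget A (i, yW c, k) = 0.
Proof.
exists [set eW x | x in [set x | cW x == c]]; first exact: leq_imset_card.
move=> i k kW; case: (gadgetP A (i, yW c, k)) => [t|x|x|x|//] [_ /eqP jE kE];
  rewrite !sumE // in jE.
by case/negP: kW; rewrite kE imset_f // inE eq_sym.
Qed.

Definition offZ k := [forall a, k != zU a] && [forall b, k != zV b].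

(** Once the slices [yW c] are erased, an ordinary 3-slice contains only entries of [A], and these
    lie in [n] rows. *)
Lemma slice_offZ A k : offZ k -> exists2 K : {set 'I_d1}, (#|K| <= n)%N &
  forall i j, i \notin K -> offW j -> gadget A (i, j, k) = 0.
Proof.
move=> /andP[/forallP kU /forallP kV].
exists [set eU (hU u) | u in 'I_n]; first by rewrite (leq_trans (leq_imset_card _ _)) ?card_ord.
move=> i j iU /forallP oj; case: (gadgetP A (i, j, k)) => [t|x|x|x|//] [iE jE kE].
- by case/negP: iU; rewrite iE imset_f.
- by have := kU (cU x); rewrite kE eqxx.
- by have := kV (cV x); rewrite kE eqxx.
- by have := oj (cW x); rewrite jE eqxx.
Qed.

Lemma slice_zU A a : exists2 K : {set 'I_d1}, (#|K| <= rU a)%N &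
  forall i j, i \notin K -> offW j -> gadget A (i, j, zU a) = 0.
Proof.
exists [set eU x | x in [set x | cU x == a]]; first exact: leq_imset_card.
move=> i j iU _; case: (gadgetP A (i, j, zU a)) => [t|x|x|x|//] [iE _ /eqP kE];
  rewrite !sumE // in kE.
by case/negP: iU; rewrite iE imset_f // inE eq_sym.
Qed.

Lemma slice_zV A b : exists2 K : {set 'I_d1}, (#|K| <= rV b)%N &
  forall i j, i \notin K -> offW j -> gadget A (i, j, zV b) = 0.
Proof.
exists [set eV' x | x in [set x | cV x == b]]; first exact: leq_imset_card.
move=> i j iU _; case: (gadgetP A (i, j, zV b)) => [t|x|x|x|//] [iE _ /eqP kE];
  rewrite !sumE // in kE.
by case/negP: iU; rewrite iE imset_f // inE eq_sym.
Qed.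

(** A nonzero [Q j (yW c)] would put a diagonal block of rank at least [rW c] into a slice of
    smaller rank. *)
Lemma lowerW_act P Q R A B :
  tensor_act P 1%:M R (gadget B) = tensor_act 1%:M Q 1%:M (gadget A) -> lowerW Q.
Proof.
move=> actE; split=> [j c /(slice_offW B) | c c' lt_c]; last have := slice_yW B c.
  move=> [K leK K0]; apply/eqP/negPn/negP => Qjc.
  have := leq_trans (card_class_le cW (f := fun c => Q j (yW c)) Qjc) (count_W actE K0).
  by have := rW_gt c; lia.
move=> [K leK K0]; apply/eqP/negPn/negP => Qjc.
have := leq_trans (card_class_le cW (f := fun c' => Q (yW c) (yW c')) Qjc) (count_W actE K0).
by have := rW_mono lt_c; lia.
Qed.

(** As [Q] and its inverse are both block lower triangular, row [yW c] of one meets column [yW c] of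
    the other only on the diagonal. *)
Lemma diagW Q Q' c : Q *m Q' = 1%:M -> lowerW Q -> lowerW Q' -> Q (yW c) (yW c) != 0.
Proof.
move=> QQ' [_ lowQ] [offQ' lowQ']; apply: diag_inv_neq0 QQ' _ => k.
case: (boolP (offW k)) => [ok|/forallPn[c']]; first by rewrite offQ' ?mulr0.
rewrite negbK => /eqP ->; rewrite !sumE -val_eqE neq_ltn => /orP[] lt_c.
  by rewrite lowQ' ?mulr0.
by rewrite lowQ ?mul0r.
Qed.

(** A second nonzero coefficient in row [yW c] would force rank [rW c + rW c'] on a slice supported
    on [rW c] columns. *)
Lemma offdiagW P Q R A B c c' :
  tensor_act P 1%:M R (gadget B) = tensor_act 1%:M Q 1%:M (gadget A) ->
  (forall c, Q (yW c) (yW c) != 0) -> c != c' -> Q (yW c) (yW c') = 0.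
Proof.
move=> actE Qd ne; have [K leK K0] := slice_yW B c; apply/eqP/negPn/negP => Qcc'.
have := leq_trans (card_classes_le cW (f := fun c' => Q (yW c) (yW c')) ne (Qd c) Qcc')
          (count_W actE K0).
by have := rW_gt c'; lia.
Qed.

(** Block lower triangularity again, for the order: ordinary 3-slices, then the [zU a], then the
    [zV b], both families by increasing index. *)
Definition lowerZ (R : 'M[F]_d3) :=
  [/\ forall k a, offZ k -> R k (zU a) = 0, forall k b, offZ k -> R k (zV b) = 0,
      forall a b, R (zU a) (zV b) = 0,
      forall a a' : 'I_N, (a < a')%N -> R (zU a) (zU a') = 0 &
      forall b b' : 'I_M, (b < b')%N -> R (zV b) (zV b') = 0].

Section ActZ.
Variables (P : 'M[F]_d1) (Q : 'M[F]_d2) (R : 'M[F]_d3) (A B : tensor F n m l).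
Hypothesis lowQ : lowerW Q.
Hypothesis actE : tensor_act P Q 1%:M (gadget B) = tensor_act 1%:M 1%:M R (gadget A).

Let classU k (K : {set 'I_d1}) a : (forall i j, i \notin K -> offW j -> gadget B (i, j, k) = 0) ->
  R k (zU a) != 0 -> (rU a <= #|K|)%N.
Proof.
by move=> /(count_U lowQ actE) le /(card_class_le cU (f := fun a => R k (zU a)))/leq_trans; apply.
Qed.

Let classV k (K : {set 'I_d1}) b : (forall i j, i \notin K -> offW j -> gadget B (i, j, k) = 0) ->
  R k (zV b) != 0 -> (rV b <= #|K|)%N.
Proof.
by move=> /(count_V lowQ actE) le /(card_class_le cV (f := fun b => R k (zV b)))/leq_trans; apply.
Qed.

Lemma lowerZ_act : (0 < N)%N -> lowerZ R.
Proof.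
move=> N_gt0; split=> [k a /(slice_offZ B)|k b /(slice_offZ B)|a b|a a' lt_a|b b' lt_b].
- move=> [K leK K0]; apply/eqP/negPn/negP => /(classU K0).
  by have := rU_gt a; lia.
- move=> [K leK K0]; apply/eqP/negPn/negP => /(classV K0).
  (* [rV b] exceeds [n] because it exceeds the size of some class of [U], which exists by
     [0 < N]. *)
  by have := rUV (Ordinal N_gt0) b; have := rU_gt (Ordinal N_gt0); lia.
- have [K leK K0] := slice_zU B a; apply/eqP/negPn/negP => /(classV K0).
  by have := rUV a b; lia.
- have [K leK K0] := slice_zU B a; apply/eqP/negPn/negP => /(classU K0).
  by have := rU_mono lt_a; lia.
- have [K leK K0] := slice_zV B b; apply/eqP/negPn/negP => /(classV K0).
  by have := rV_mono lt_b; lia.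
Qed.

Lemma offdiagU a a' : (forall a, R (zU a) (zU a) != 0) -> a != a' -> R (zU a) (zU a') = 0.
Proof.
move=> Rd ne; have [K leK K0] := slice_zU B a; apply/eqP/negPn/negP => Raa'.
have := leq_trans (card_classes_le cU (f := fun a' => R (zU a) (zU a')) ne (Rd a) Raa')
          (count_U lowQ actE K0).
by have := rU_gt a'; lia.
Qed.

Lemma offdiagV b b' : (0 < N)%N ->
  (forall b, R (zV b) (zV b) != 0) -> b != b' -> R (zV b) (zV b') = 0.
Proof.
move=> N_gt0 Rd ne; have [K leK K0] := slice_zV B b; apply/eqP/negPn/negP => Rbb'.
have := leq_trans (card_classes_le cV (f := fun b' => R (zV b) (zV b')) ne (Rd b) Rbb')
          (count_V lowQ actE K0).
by have := rUV (Ordinal N_gt0) b'; lia.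
Qed.
End ActZ.

Lemma offZP k : [\/ offZ k, exists a, k = zU a | exists b, k = zV b].
Proof.
case: (boolP (offZ k)) => [|/nandP[]/forallPn[x]]; first by constructor 1.
  by rewrite negbK => /eqP ->; constructor 2; exists x.
by rewrite negbK => /eqP ->; constructor 3; exists x.
Qed.

Lemma diagU R R' a : R *m R' = 1%:M -> lowerZ R -> lowerZ R' -> R (zU a) (zU a) != 0.
Proof.
move=> RR' [_ _ lowUV lowU _] [offU _ _ lowU' _]; apply: diag_inv_neq0 RR' _ => k.
case: (offZP k) => [ok|[a' ->]|[b ->]] ne; first by rewrite offU ?mulr0.
  move: ne; rewrite !sumE -val_eqE neq_ltn => /orP[] lt_a.
    by rewrite lowU' ?mulr0.
  by rewrite lowU ?mul0r.
by rewrite lowUV mul0r.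
Qed.

Lemma diagV R R' b : R *m R' = 1%:M -> lowerZ R -> lowerZ R' -> R (zV b) (zV b) != 0.
Proof.
move=> RR' [_ _ _ _ lowV] [_ offV lowUV' _ lowV']; apply: diag_inv_neq0 RR' _ => k.
case: (offZP k) => [ok|[a' ->]|[b' ->]] ne; first by rewrite offV ?mulr0.
  by rewrite lowUV' mulr0.
move: ne; rewrite !sumE -val_eqE neq_ltn => /orP[] lt_b.
  by rewrite lowV' ?mulr0.
by rewrite lowV ?mul0r.
Qed.

(** * Compression of an isomorphism of gadgets *)

Lemma gadget_main A t : gadget A (main_pos t) = A t.
Proof.
case: t => [[u v] w]; rewrite ffunE (bigD1 (u, v, w)) //= eqxx mulr1 !big1 ?addr0 //.
- by move=> x _; rewrite pair3_eq !sumE /= ?andbF.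
- by move=> x _; rewrite pair3_eq !sumE /= ?andbF.
- by move=> x _; rewrite pair3_eq !sumE /= ?andbF.
move=> [[u' v'] w'] /= ne; rewrite pair3_eq !sumE (inj_eq hU_inj) (inj_eq hV_inj) (inj_eq hW_inj).
by rewrite pair3_eq in ne; rewrite ![_ == u']eq_sym ![_ == v']eq_sym ![_ == w']eq_sym (negbTE ne) mulr0.
Qed.

Lemma gadget_U A x : gadget A (posU x) = 1.
Proof.
rewrite ffunE [X in _ + X + _ + _](bigD1 x) //= eqxx !big1 ?add0r ?addr0 //.
- by move=> y _; rewrite pair3_eq !sumE /= ?andbF.
- by move=> y _; rewrite pair3_eq !sumE /= ?andbF.
- by move=> y ne; rewrite pair3_eq !sumE eq_sym (negbTE ne).
- by move=> y _; rewrite pair3_eq !sumE /= ?andbF ?mulr0.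
Qed.

Lemma gadget_V A x : gadget A (posV x) = 1.
Proof.
rewrite ffunE [X in _ + X + _](bigD1 x) //= eqxx !big1 ?add0r ?addr0 //.
- by move=> y _; rewrite pair3_eq !sumE /= ?andbF.
- by move=> y ne; rewrite pair3_eq !sumE eq_sym (negbTE ne).
- by move=> y _; rewrite pair3_eq !sumE /= ?andbF.
- by move=> y _; rewrite pair3_eq !sumE /= ?andbF ?mulr0.
Qed.

Lemma gadget_W A x : gadget A (posW x) = 1.
Proof.
rewrite ffunE [X in _ + X](bigD1 x) //= eqxx !big1 ?add0r ?addr0 //.
- by move=> y ne; rewrite pair3_eq !sumE eq_sym (negbTE ne).
- by move=> y _; rewrite pair3_eq !sumE /= ?andbF.
- by move=> y _; rewrite pair3_eq !sumE /= ?andbF.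
- by move=> y _; rewrite pair3_eq !sumE /= ?andbF ?mulr0.
Qed.

(** The witnesses are blocks of the inverse matrices, so they lead from [B] to [A]; as mere
    compressions they may be singular. *)
Lemma gadget_iso_compress A B : (0 < N)%N -> tensor_iso (gadget A) (gadget B) ->
  exists (P : 'M[F]_n) (Q : 'M[F]_m) (R : 'M[F]_l),
    [/\ forall u u', cU (hU u) != cU (hU u') -> P u u' = 0,
        forall v v', cV (hV v) != cV (hV v') -> Q v v' = 0,
        forall w w', cW (hW w) != cW (hW w') -> R w w' = 0 &
        tensor_act P Q R B = A].
Proof.
move=> N_gt0 [P [Q [R [uP uQ uR actE]]]].
pose P' := invmx P; pose Q' := invmx Q; pose R' := invmx R.
(* Matrices are moved across the isomorphism until one side involves only [Q] or only [R], or an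
   inverse of these, whose effect on the pairings is explicit. *)
have actW : tensor_act P' 1%:M R' (gadget B) = tensor_act 1%:M Q 1%:M (gadget A).
  by rewrite -actE tensor_act_comp !mulVmx ?mul1mx.
have actW' : tensor_act P 1%:M R (gadget A) = tensor_act 1%:M Q' 1%:M (gadget B).
  by rewrite -actE tensor_act_comp !mulVmx ?mul1mx.
have actZ : tensor_act P' Q' 1%:M (gadget B) = tensor_act 1%:M 1%:M R (gadget A).
  by rewrite -actE tensor_act_comp !mulVmx ?mul1mx.
have actZ' : tensor_act P Q 1%:M (gadget A) = tensor_act 1%:M 1%:M R' (gadget B).
  by rewrite -actE tensor_act_comp !mulVmx ?mul1mx.
have lowQ := lowerW_act actW; have lowQ' := lowerW_act actW'.
have lowR := lowerZ_act lowQ' actZ N_gt0; have lowR' := lowerZ_act lowQ actZ' N_gt0.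
have dW c : Q (yW c) (yW c) != 0 by apply: diagW lowQ lowQ'; rewrite mulmxV.
have dU a : R (zU a) (zU a) != 0 by apply: diagU lowR lowR'; rewrite mulmxV.
have dV b : R (zV b) (zV b) != 0 by apply: diagV lowR lowR'; rewrite mulmxV.
exists (\matrix_(u, u') P' (eU (hU u)) (eU (hU u'))),
       (\matrix_(v, v') Q' (eV (hV v)) (eV (hV v'))),
       (\matrix_(w, w') R' (eW (hW w)) (eW (hW w'))).
split=> [u u' ne|v v' ne|w w' ne|].
(* The pairing in the slice [zU a] is preserved up to the scalar [R (zU a) (zU a)]. The fresh
   coordinates provide [Pi] and the padded ones [rho]. The two other directions are treated
   alike. *)
- rewrite mxE; apply: (coloured_diag (col := cU) (e := fun x => eU x)
    (Pi := fun x y => Q' (eU' x) (eU' y)) (rho := fun i y => P' i (eU y))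
    (lam := fun a a' => R (zU a) (zU a'))) => //.
  + by move=> x y /eqP; rewrite !sumE => /eqP.
  + move=> a x i; rewrite -(act_11R_U R A) -actZ act_PQ1_U.
    by apply: eq_bigr => y _; rewrite mulrC.
  + by move=> a a'; apply: (offdiagU lowQ' actZ dU).
  + by move=> x cx; rewrite !sumE; apply: contra_neq ne => ->.
- rewrite mxE; apply: (coloured_diag (col := cV) (e := fun x => eV x)
    (Pi := fun x y => P' (eV' x) (eV' y)) (rho := fun j y => Q' j (eV y))
    (lam := fun b b' => R (zV b) (zV b'))) => //.
  + by move=> x y /eqP; rewrite !sumE => /eqP.
  + by move=> b x j; rewrite -(act_11R_V R A) -actZ act_PQ1_V.
  + by move=> b b'; apply: (offdiagV lowQ' actZ N_gt0 dV).
  + by move=> x cx; rewrite !sumE; apply: contra_neq ne => ->.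
- rewrite mxE; apply: (coloured_diag (col := cW) (e := fun x => eW x)
    (Pi := fun x y => P' (eW' x) (eW' y)) (rho := fun k y => R' k (eW y))
    (lam := fun c c' => Q (yW c) (yW c'))) => //.
  + by move=> x y /eqP; rewrite !sumE => /eqP.
  + by move=> c x k; rewrite -(act_1Q1 Q A) -actW act_P1R.
  + by move=> c c'; apply: (offdiagW actW dW).
  + by move=> x cx; rewrite !sumE; apply: contra_neq ne => ->.
apply/ffunP => [[[u v] w]].
have : tensor_act P' Q' R' (gadget B) = gadget A.
  by rewrite -actE tensor_act_comp !mulVmx ?tensor_act1.
move/ffunP/(_ (main_pos (u, v, w))); rewrite act_gadget /=.
have offWw : offZ (eW (hW w)).
  by apply/andP; split; apply/forallP => x; rewrite !sumE.
have offVv : offW (eV (hV v)) by apply/forallP => x; rewrite !sumE.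
case: lowR' => offU offV _ _ _.
(* At an original position no pairing contributes: the coefficients of [R'] at [zU] and [zV] and
   those of [Q'] at [yW] vanish there. *)
rewrite [X in _ + X + _ + _]big1 => [|x _]; last by rewrite offU ?mulr0.
rewrite [X in _ + X + _]big1 => [|x _]; last by rewrite offV ?mulr0.
rewrite [X in _ + X]big1 => [|x _]; last by rewrite lowQ'.1 ?mulr0 ?mul0r.
rewrite !addr0 tensor_actE /= => eqA.
transitivity (gadget A (main_pos (u, v, w))).
  by rewrite -eqA; apply: eq_bigr => t _; rewrite !mxE mulrC.
by rewrite gadget_main.
Qed.


(** * Lifting a block-diagonal isomorphism to the gadgets *)

Section Forward.
Variables (P : 'M[F]_n) (Q : 'M[F]_m) (R : 'M[F]_l) (A B : tensor F n m l).
Hypotheses (uP : P \in unitmx) (uQ : Q \in unitmx) (uR : R \in unitmx).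
Hypothesis colP : forall u u', cU (hU u) != cU (hU u') -> P u u' = 0.
Hypothesis colQ : forall v v', cV (hV v) != cV (hV v') -> Q v v' = 0.
Hypothesis colR : forall w w', cW (hW w) != cW (hW w') -> R w w' = 0.
Hypothesis actE : tensor_act P Q R A = B.

Let U := lift_fun_mx hU P.
Let V := lift_fun_mx hV Q.
Let W := lift_fun_mx hW R.
(** Contragredient matrices on the fresh coordinates, the identity on the indices of the new
    slices. *)
Let X1 := block3 U (invmx V)^T (invmx W)^T.
Let X2 := block3 V (invmx U)^T (1%:M : 'M_L).
Let X3 := block3 W (1%:M : 'M_N) (1%:M : 'M_M).

Let liftE (n' s d : nat) (h : 'I_n' -> 'I_s)
    (g : 'I_s -> 'I_d) (T : 'M[F]_n') i u :
  injective h ->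
  \sum_x lift_fun_mx h T x (h u) * (i == g x)%:R =
  \sum_u' T u' u * (i == g (h u'))%:R.
Proof.
move=> h_inj; under eq_bigr do rewrite lift_fun_mxE // mulr_suml.
rewrite exchange_big; apply: eq_bigr => u' _ /=.
under eq_bigr do rewrite -mulrA; rewrite -mulr_sumr; congr (_ * _).
by under eq_bigr do rewrite mulrC; rewrite sum_delta.
Qed.

Lemma gadget_iso_lift : tensor_iso (gadget A) (gadget B).
Proof.
have uU : U \in unitmx by apply: lift_fun_mx_inv.
have uV : V \in unitmx by apply: lift_fun_mx_inv.
have uW : W \in unitmx by apply: lift_fun_mx_inv.
have trV (s : nat) (T : 'M[F]_s) : T \in unitmx -> (invmx T)^T *m T^T = 1%:M.
  by move=> uT; rewrite -trmx_mul mulmxV ?trmx1.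
pose P1 := lift_fun_mx e1 X1; pose Q1 := lift_fun_mx e2 X2; pose R1 := lift_fun_mx e3 X3.
exists P1, Q1, R1; split.
- exact: (lift_fun_mx_unit e1_inj (block3_inv (mulmxV uU) (trV _ _ uV) (trV _ _ uW))).
- exact: (lift_fun_mx_unit e2_inj (block3_inv (mulmxV uV) (trV _ _ uU) (mulmx1 _))).
- exact: (lift_fun_mx_unit e3_inj (block3_inv (mulmxV uW) (mulmx1 _) (mulmx1 _))).
have P1U i y : P1 i (eU y) = \sum_x U x y * (i == eU x)%:R.
  rewrite lift_fun_mxE // sum_block3 /= [X in _ + X + _]big1 ?[X in _ + X]big1 ?addr0 // => ? _;
    by rewrite mul0r.
have P1V i y : P1 i (eV' y) = \sum_x invmx V y x * (i == eV' x)%:R.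
  rewrite lift_fun_mxE // sum_block3 /= [X in X + _ + _]big1 ?[X in _ + X]big1 ?addr0 ?add0r => [|? _|? _];
    rewrite ?mul0r //; by apply: eq_bigr => x _; rewrite mxE.
have P1W i y : P1 i (eW' y) = \sum_x invmx W y x * (i == eW' x)%:R.
  rewrite lift_fun_mxE // sum_block3 /= [X in X + _ + _]big1 ?[X in _ + X + _]big1 ?addr0 ?add0r => [|? _|? _];
    rewrite ?mul0r //; by apply: eq_bigr => x _; rewrite mxE.
have Q1V j y : Q1 j (eV y) = \sum_x V x y * (j == eV x)%:R.
  rewrite lift_fun_mxE // sum_block3 /= [X in _ + X + _]big1 ?[X in _ + X]big1 ?addr0 // => ? _;
    by rewrite mul0r.
have Q1U j y : Q1 j (eU' y) = \sum_x invmx U y x * (j == eU' x)%:R.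
  rewrite lift_fun_mxE // sum_block3 /= [X in X + _ + _]big1 ?[X in _ + X]big1 ?addr0 ?add0r => [|? _|? _];
    rewrite ?mul0r //; by apply: eq_bigr => x _; rewrite mxE.
have Q1W j c : Q1 j (yW c) = (j == yW c)%:R.
  rewrite lift_fun_mxE // sum_block3 /= [X in X + _ + _]big1 ?[X in _ + X + _]big1 ?addr0 ?add0r => [|? _|? _];
    rewrite ?mul0r //; rewrite -[RHS](sum_delta (fun x => (j == yW x)%:R) c).
  by apply: eq_bigr => x _; rewrite mxE mulrC.
have R1W k y : R1 k (eW y) = \sum_x W x y * (k == eW x)%:R.
  rewrite lift_fun_mxE // sum_block3 /= [X in _ + X + _]big1 ?[X in _ + X]big1 ?addr0 // => ? _;
    by rewrite mul0r.
have R1U k c : R1 k (zU c) = (k == zU c)%:R.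
  rewrite lift_fun_mxE // sum_block3 /= [X in X + _ + _]big1 ?[X in _ + X]big1 ?addr0 ?add0r => [|? _|? _];
    rewrite ?mul0r //; rewrite -[RHS](sum_delta (fun x => (k == zU x)%:R) c).
  by apply: eq_bigr => x _; rewrite mxE mulrC.
have R1V k c : R1 k (zV c) = (k == zV c)%:R.
  rewrite lift_fun_mxE // sum_block3 /= [X in X + _ + _]big1 ?[X in _ + X + _]big1 ?addr0 ?add0r => [|? _|? _];
    rewrite ?mul0r //; rewrite -[RHS](sum_delta (fun x => (k == zV x)%:R) c).
  by apply: eq_bigr => x _; rewrite mxE mulrC.
have natAnd (b1 b2 b3 : bool) : [&& b1, b2 & b3]%:R = b1%:R * b2%:R * b3%:R :> F.
  by case: b1 b2 b3 => [] [] []; rewrite ?(mulr1, mulr0).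
(* The four kinds of entries match separately: those of [A] through [actE], each family of pairings
   by [contragredient_sum]. *)
apply/ffunP => [[[i j] k]]; rewrite act_gadget /= ffunE; congr (_ + _ + _ + _).
- rewrite -actE; under [RHS]eq_bigr do rewrite tensor_actE mulr_suml.
  rewrite exchange_big; apply: eq_bigr => t _ /=.
  rewrite P1U Q1V R1W.
  rewrite (liftE (fun x => eU x)) // (liftE (fun x => eV x)) // (liftE (fun x => eW x)) //.
  rewrite -sum_mul3 mulr_sumr.
  by apply: eq_bigr => t' _; rewrite pair3_eq natAnd; ring.
- under eq_bigr do rewrite P1U Q1U R1U.
  rewrite (contragredient_sum _ _ (fun a => (k == zU a)%:R) (mulmxV uU)).
    by apply: eq_bigr => x _; rewrite pair3_eq natAnd.
  exact: lift_colour.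
- transitivity (\sum_y Q1 j (eV y) * P1 i (eV' y) * R1 k (zV (cV y))).
    by apply: eq_bigr => y _; ring.
  under eq_bigr do rewrite P1V Q1V R1V.
  rewrite (contragredient_sum _ _ (fun a => (k == zV a)%:R) (mulmxV uV)).
    by apply: eq_bigr => x _; rewrite pair3_eq natAnd; ring.
  exact: lift_colour.
transitivity (\sum_y R1 k (eW y) * P1 i (eW' y) * Q1 j (yW (cW y))).
  by apply: eq_bigr => y _; ring.
under eq_bigr do rewrite P1W R1W Q1W.
rewrite (contragredient_sum _ _ (fun a => (j == yW a)%:R) (mulmxV uW)).
  by apply: eq_bigr => x _; rewrite pair3_eq natAnd; ring.
exact: lift_colour.
Qed.
End Forward.

End Gadget.

(** * Layout of the gadget in the prescribed format *)

Section Colours.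
Local Open Scope nat_scope.

Definition runs (f : nat -> nat) (N : nat) : seq nat :=
  flatten [seq nseq (f a) a | a <- iota 0 N].

(* Coordinates of block [a] have colour [a]; the second run pads this colour to
   [K + a + 1] occurrences. *)
Definition colours (K : nat) (s : seq nat) : seq nat :=
  runs (nth 0 s) (size s) ++ runs (fun a => K + a.+1 - nth 0 s a) (size s).

Lemma runsS f N : runs f N.+1 = runs f N ++ nseq (f N) N.
Proof. by rewrite /runs -addn1 iotaD map_cat flatten_cat /= cats0. Qed.

Lemma size_runs f N : size (runs f N) = \sum_(a < N) f a.
Proof.
elim: N => [|N IH]; first by rewrite big_ord0.
by rewrite runsS size_cat size_nseq IH big_ord_recr.
Qed.

Lemma count_runs f N a : count_mem a (runs f N) = (a < N) * f a.
Proof.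
elim: N => [|N IH]; first by rewrite mul0n.
rewrite runsS count_cat IH count_nseq /= ltnS leq_eqVlt [N == a]eq_sym.
by case: (ltngtP a N) => [||->] /=; lia.
Qed.

Lemma triangleS N : N.+1 * N.+2 %/ 2 = N * N.+1 %/ 2 + N.+1.
Proof. lia. Qed.

Lemma triangle_sum N : N * N.+1 %/ 2 = \sum_(a < N) a.+1.
Proof.
elim: N => [|N IH]; first by rewrite big_ord0.
by rewrite big_ord_recr /= -IH triangleS.
Qed.

Lemma triangleD a b : (a + b) * (a + b).+1 %/ 2 = a * a.+1 %/ 2 + b * b.+1 %/ 2 + a * b.
Proof. by elim: b => [|b IH]; rewrite ?addn0 ?addnS ?triangleS ?IH; lia. Qed.

(** As no block exceeds [K], the truncated subtraction in [colours] is exact and colour [a] occurs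
    [K + a + 1] times. The closed form is the one that the program evaluates. *)
Lemma size_colours K s : (forall a, nth 0 s a <= K) ->
  size (colours K s) = size s * K + size s * (size s).+1 %/ 2.
Proof.
move=> sK; rewrite size_cat !size_runs -big_split /= triangle_sum.
rewrite (eq_bigr (fun a : 'I_(size s) => K + a.+1)) => [|a _].
  by rewrite big_split /= sum_nat_const card_ord.
by have := sK a; lia.
Qed.

Lemma count_colours K s a : a < size s -> nth 0 s a <= K ->
  count_mem a (colours K s) = K + a.+1.
Proof. by move=> ltas sK; rewrite count_cat !count_runs ltas; lia. Qed.

Lemma nth_colours_lt K s x : x < size (colours K s) -> nth 0 (colours K s) x < size s.
Proof.
move=> /(mem_nth 0); rewrite mem_cat => /orP[] /flattenP[t /mapP[a]];
  by rewrite mem_iota /= add0n => lta ->; rewrite mem_nseq => /andP[_ /eqP ->].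
Qed.

Lemma card_nth_eq (s : seq nat) a :
  #|[set x : 'I_(size s) | nth 0 s x == a]| = count_mem a s.
Proof.
rewrite -sum1_count (big_nth 0) big_mkord -sum1_card.
by apply: eq_bigl => x; rewrite inE.
Qed.

Lemma size_block_sizes N (p : 'I_N -> nat) : size (block_sizes p) = N.
Proof. by rewrite size_map size_enum_ord. Qed.

Lemma nth_block_sizes N (p : 'I_N -> nat) (a : 'I_N) : nth 0 (block_sizes p) a = p a.
Proof. by rewrite (nth_map a) ?size_enum_ord // nth_ord_enum. Qed.

Lemma nth_block_sizes_le N (p : 'I_N -> nat) a : nth 0 (block_sizes p) a <= \sum_i p i.
Proof.
case: (ltnP a N) => [lta|leN]; last by rewrite nth_default ?size_block_sizes.
by rewrite (nth_block_sizes p (Ordinal lta)) (bigD1 (Ordinal lta)) //= leq_addr.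
Qed.

Lemma nth_runs f N a x : a < N -> x < f a -> nth 0 (runs f N) (\sum_(i < a) f i + x) = a.
Proof.
elim: N => // N IH; rewrite ltnS leq_eqVlt => /orP[/eqP ->|lta] ltx.
  by rewrite runsS nth_cat size_runs ltnNge leq_addr /= addKn nth_nseq ltx.
rewrite runsS nth_cat size_runs IH // ifT //.
apply: (@leq_trans (\sum_(i < a.+1) f i)); first by rewrite big_ord_recr /= -addnS leq_add2l.
rewrite -!(big_mkord xpredT f) (@big_cat_nat _ _ _ a.+1 0 N) //=; exact: leq_addr.
Qed.

(** The first run follows the order of the blocks in [\sum_i p i], so the original coordinates come
    first and keep their indices. *)
Lemma nth_colours_main K N (p : 'I_N -> nat) (u : 'I_(\sum_i p i)) :
  nth 0 (colours K (block_sizes p)) u = tagnat.sig1 u.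
Proof.
have sum_le a : a <= N -> \sum_(i < N | i < a) p i = \sum_(i < a) nth 0 (block_sizes p) i.
  move=> leaN; rewrite (big_ord_widen _ (fun i => nth 0 (block_sizes p) i) leaN).
  by apply: eq_bigr => i _; rewrite nth_block_sizes.
rewrite nth_cat size_runs size_block_sizes ifT; last first.
  have -> : \sum_(a < N) nth 0 (block_sizes p) a = \sum_i p i; last exact: ltn_ord.
  by apply: eq_bigr => i _; rewrite nth_block_sizes.
rewrite (tagnat.rect u) sum_le ?(ltnW (ltn_ord _)) // nth_runs //.
by rewrite nth_block_sizes.
Qed.

End Colours.

(** * The gadget fits into the prescribed dimensions *)

Section Fit.
Local Open Scope nat_scope.

Lemma triangle_lt_exp2 S : S * S.+1 %/ 2 < 2 ^ S.
Proof.
elim: S => // S IH; rewrite expnS triangleS.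
have := ltn_expl S (isT : 1 < 2); lia.
Qed.

Variables (N M L n m l : nat).
Let nU := N * n + N * N.+1 %/ 2.
Let mV := M * (n + m + N) + M * M.+1 %/ 2.
Let lW := L * (l + N + M) + L * L.+1 %/ 2.

(** The terms free of [n], [m], [l] add up to the triangular number of [N + M + L], which is below
    [2 ^ (N + M + L)]. In direction 2 the same happens with [N + M], apart from the term [L]. *)
Lemma fit1 : nU + mV + lW <= dim1 N M L n m l.
Proof.
have tS := triangle_lt_exp2 (N + M + L); rewrite !triangleD in tS.
have nN : n * N <= n * 2 ^ N by rewrite leq_mul // ltnW // ltn_expl.
have nM : n * M <= n * 2 ^ (N + M + L).
  rewrite leq_mul // (leq_trans (ltnW (ltn_expl M (isT : 1 < 2)))) // leq_pexp2l //; lia.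
have mM : m * M <= m * 2 ^ (M + L).
  rewrite leq_mul // (leq_trans (ltnW (ltn_expl M (isT : 1 < 2)))) // leq_pexp2l //; lia.
have lL : l * L <= l * 2 ^ L by rewrite leq_mul // ltnW // ltn_expl.
have x_gt0 : 0 < 2 ^ N by rewrite expn_gt0.
rewrite /nU /mV /lW /dim1; lia.
Qed.

Lemma fit2 : mV + nU + L <= dim2 N M L n m l.
Proof.
have tS := triangle_lt_exp2 (N + M); rewrite !triangleD in tS.
have nM : n * (N + M) <= n * 2 ^ (N + M) by rewrite leq_mul // ltnW // ltn_expl.
have mM : m * M <= m * 2 ^ M by rewrite leq_mul // ltnW // ltn_expl.
rewrite /nU /mV /lW /dim2; lia.
Qed.

Lemma fit3 : lW + N + M <= dim3 N M L n m l.
Proof.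
have tL := triangle_lt_exp2 L.
have ltNM := ltn_expl (N + M) (isT : 1 < 2).
have lL : l * L <= l * (2 ^ L - 1) by rewrite leq_mul //; have := ltn_expl L (isT : 1 < 2); lia.
have NL : N * L <= (2 ^ N - 1) * L by rewrite leq_mul //; have := ltn_expl N (isT : 1 < 2); lia.
(* This is (x - 1)(z - 1) >= 0 for x = 2 ^ (N + M) and z = 2 ^ L. It lets a single power absorb both
   [N + M] and the triangular number of [L]. *)
have xz : 2 ^ (N + M) + 2 ^ L <= 2 ^ (N + M + L) + 1.
  have : 0 < 2 ^ (N + M) by rewrite expn_gt0.
  have : 0 < 2 ^ L by rewrite expn_gt0.
  rewrite (expnD 2 (N + M) L); case: (2 ^ (N + M)) (2 ^ L) => [|x] [|z] //; lia.
rewrite /nU /mV /lW /dim3; lia.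
Qed.
End Fit.

(** * The reduction and its correctness *)

Definition stamped (sU sV sW : seq nat) (N i j k : nat) : bool :=
  [|| [&& i < size sU, j == size sV + i & k == size sW + nth 0 sU i],
      [&& j < size sV, i == size sU + j & k == size sW + N + nth 0 sV j] |
      [&& k < size sW, i == size sU + size sV + k & j == size sV + size sU + nth 0 sW k]]%N.

Definition tensor_get (F : fieldType) (n m l : nat) (A : tensor F n m l) (i j k : nat) : F :=
  if (insub i, insub j, insub k) is (Some i', Some j', Some k') then A (i', j', k') else 0.

Definition tensor_of_nat (F : fieldType) (n m l : nat) (g : nat -> nat -> nat -> F) :
    tensor F n m l :=
  [ffun s : 'I_n * 'I_m * 'I_l => g s.1.1 s.1.2 s.2].

(** Stated with natural-number indices, close to what the program computes. [A] sits in the corner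
    at the origin. Direction 1 lists the padded U, then the fresh coordinates for V and for W;
    direction 2 the padded V, the fresh coordinates for U, the new 2-slices; direction 3 the padded
    W, then the new 3-slices for U and for V. *)
Definition reduction (F : fieldType) : block_map F := fun N M L p q r A =>
  tensor_of_nat _ _ _ (fun i j k =>
    if stamped (colours (\sum_i p i) (block_sizes p))
               (colours (\sum_i p i + \sum_j q j + N) (block_sizes q))
               (colours (\sum_k r k + N + M) (block_sizes r)) N i j k
    then 1 else tensor_get A i j k).

Section Layout.
Variables (F : fieldType) (N M L : nat).
Variables (p : 'I_N -> nat) (q : 'I_M -> nat) (r : 'I_L -> nat).
Local Notation n := (\sum_i p i)%N.
Local Notation m := (\sum_j q j)%N.
Local Notation l := (\sum_k r k)%N.
Local Notation sU := (colours n (block_sizes p)).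
Local Notation sV := (colours (n + m + N) (block_sizes q)).
Local Notation sW := (colours (l + N + M) (block_sizes r)).

Lemma size_sU : size sU = (N * n + N * N.+1 %/ 2)%N.
Proof. by rewrite size_colours ?size_block_sizes // => a; apply: nth_block_sizes_le. Qed.

Lemma size_sV : size sV = (M * (n + m + N) + M * M.+1 %/ 2)%N.
Proof.
rewrite size_colours ?size_block_sizes // => a.
by rewrite (leq_trans (nth_block_sizes_le _ _)) // -addnA addnCA leq_addr.
Qed.

Lemma size_sW : size sW = (L * (l + N + M) + L * L.+1 %/ 2)%N.
Proof.
rewrite size_colours ?size_block_sizes // => a.
by rewrite (leq_trans (nth_block_sizes_le _ _)) // -addnA leq_addr.
Qed.

Lemma fitU : (size sU + size sV + size sW <= dim1 N M L n m l)%N.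
Proof. by rewrite size_sU size_sV size_sW fit1. Qed.
Lemma fitV : (size sV + size sU + L <= dim2 N M L n m l)%N.
Proof. by rewrite size_sU size_sV fit2. Qed.
Lemma fitW : (size sW + N + M <= dim3 N M L n m l)%N.
Proof. by rewrite size_sW fit3. Qed.

Definition unsplit3 (a b c : nat) (s : 'I_a + 'I_b + 'I_c) : 'I_(a + b + c) :=
  unsplit (match s with inl t => inl (unsplit t) | inr x => inr x end).

Lemma unsplit3_inj a b c : injective (@unsplit3 a b c).
Proof.
move=> s t /(can_inj (@unsplitK _ _)).
by case: s t => [s|x] [t|y] // [] => [/(can_inj (@unsplitK _ _))|] ->.
Qed.

Definition emb1 s := widen_ord fitU (unsplit3 s).
Definition emb2 s := widen_ord fitV (unsplit3 s).
Definition emb3 s := widen_ord fitW (unsplit3 s).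

Lemma widen_ord_inj a b (le_ab : (a <= b)%N) : injective (widen_ord le_ab).
Proof. by move=> x y /(congr1 val) /= /val_inj. Qed.

Lemma emb1_inj : injective emb1.
Proof. by move=> s t /widen_ord_inj/unsplit3_inj. Qed.
Lemma emb2_inj : injective emb2.
Proof. by move=> s t /widen_ord_inj/unsplit3_inj. Qed.
Lemma emb3_inj : injective emb3.
Proof. by move=> s t /widen_ord_inj/unsplit3_inj. Qed.

Lemma le_size_colours K N' (p' : 'I_N' -> nat) :
  (\sum_i p' i <= size (colours K (block_sizes p')))%N.
Proof.
rewrite size_cat size_runs size_block_sizes.
rewrite [X in (_ <= X + _)%N](eq_bigr p') ?leq_addr // => i _.
exact: nth_block_sizes.
Qed.

Definition incl K N' (p' : 'I_N' -> nat) (u : 'I_(\sum_i p' i)) :=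
  widen_ord (le_size_colours K p') u.

Lemma incl_inj K N' (p' : 'I_N' -> nat) : injective (@incl K N' p').
Proof. exact: widen_ord_inj. Qed.

Lemma colour_lt K N' (p' : 'I_N' -> nat) (x : 'I_(size (colours K (block_sizes p')))) :
  (nth 0 (colours K (block_sizes p')) x < N')%N.
Proof. by have := nth_colours_lt (ltn_ord x); rewrite size_block_sizes. Qed.

Definition colour K N' (p' : 'I_N' -> nat) x := Ordinal (@colour_lt K N' p' x).

Lemma colour_incl K N' (p' : 'I_N' -> nat) (u : 'I_(\sum_i p' i)) : colour (incl K u) = tagnat.sig1 u :> 'I_N'.
Proof. by apply/val_inj; rewrite /= nth_colours_main. Qed.

Lemma card_colour K N' (p' : 'I_N' -> nat) (a : 'I_N') : (\sum_i p' i <= K)%N ->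
  #|[set x | @colour K N' p' x == a]| = (K + a.+1)%N.
Proof.
move=> leK; rewrite -(@count_colours K (block_sizes p')) ?size_block_sizes //; last first.
  exact: leq_trans (nth_block_sizes_le _ _) leK.
by rewrite -card_nth_eq; apply: eq_card => x; rewrite !inE.
Qed.

Local Notation gdt := (gadget emb1 emb2 emb3 (incl n (p' := p)) (incl (n + m + N) (p' := q))
  (incl (l + N + M) (p' := r)) (@colour n _ p) (@colour (n + m + N) _ q)
  (@colour (l + N + M) _ r)).

(** Each clause of [stamped] is one kind of pairing and the corner is [main_pos]; [gadgetP] shows
    that nothing else is nonzero. *)
Lemma reductionE (A : tensor F n m l) : reduction A = gdt A.
Proof.
apply/ffunP => [[[i j] k]]; rewrite ffunE /stamped.
case: ifP => [/or3P[]|/norP[nU /norP[nV nW]]] /=.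
- case/and3P => ltx /eqP jE /eqP kE.
  transitivity (gdt A (posU emb1 emb2 emb3 (@colour n _ p) (Ordinal ltx))).
    by rewrite gadget_U //; do [exact: emb1_inj | exact: emb2_inj | exact: emb3_inj].
  by congr (gdt A (_, _, _)); apply/val_inj.
- case/and3P => ltx /eqP iE /eqP kE.
  transitivity (gdt A (posV emb1 emb2 emb3 (@colour (n + m + N) _ q) (Ordinal ltx))).
    by rewrite gadget_V //; do [exact: emb1_inj | exact: emb2_inj | exact: emb3_inj].
  by congr (gdt A (_, _, _)); apply/val_inj.
- case/and3P => ltx /eqP iE /eqP jE.
  transitivity (gdt A (posW emb1 emb2 emb3 (@colour (l + N + M) _ r) (Ordinal ltx))).
    by rewrite gadget_W //; do [exact: emb1_inj | exact: emb2_inj | exact: emb3_inj].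
  by congr (gdt A (_, _, _)); apply/val_inj.
case: (boolP [&& i < n, j < m & k < l]%N) => [/and3P[lti ltj ltk]|out].
  rewrite /tensor_get !insubT.
  transitivity (gdt A (main_pos emb1 emb2 emb3 (incl n (p' := p))
    (incl (n + m + N) (p' := q)) (incl (l + N + M) (p' := r))
    (Ordinal lti, Ordinal ltj, Ordinal ltk))).
    by rewrite gadget_main //;
      do [exact: emb1_inj | exact: emb2_inj | exact: emb3_inj | exact: incl_inj].
  by congr (gdt A (_, _, _)); apply/val_inj.
have -> : tensor_get A i j k = 0.
  rewrite /tensor_get; move: out.
  case: insubP => [i' -> _|//]; case: insubP => [j' -> _|//].
  by case: insubP => [k' -> _|//].
case: (gadgetP emb1 emb2 emb3 (incl n (p' := p)) (incl (n + m + N) (p' := q))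
  (incl (l + N + M) (p' := r)) (@colour n _ p) (@colour (n + m + N) _ q)
  (@colour (l + N + M) _ r) A (i, j, k)) => [t|x|x|x|->//] [iE jE kE].
- by case/and3P: out; rewrite iE jE kE /= !ltn_ord.
- by case/and3P: nU; rewrite iE jE kE /= ltn_ord !eqxx.
- by case/and3P: nV; rewrite iE jE kE /= ltn_ord !eqxx.
- by case/and3P: nW; rewrite iE jE kE /= ltn_ord !eqxx.
Qed.

Lemma part_tensor_iso_refl (A : tensor F n m l) : part_tensor_iso A A.
Proof.
exists (fun=> 1%:M), (fun=> 1%:M), (fun=> 1%:M).
by split=> [i|j|k|]; rewrite ?unitmx1 // !mxdiagZ tensor_act1.
Qed.

Theorem reduction_iso (A B : tensor F n m l) :
  part_tensor_iso A B <-> tensor_iso (reduction A) (reduction B).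
Proof.
case: (posnP N) => [N0|N_gt0].
  (* Without blocks in direction 1 the tensors have no entries. *)
  suff -> : A = B by split=> _; [apply: tensor_iso_refl | apply: part_tensor_iso_refl].
  apply/ffunP => [[[u v] w]]; have [a lta] := tagnat.sig1 u.
  by exfalso; lia.
(* An isomorphism of the outputs gives a restriction one way only; used for the isomorphism and for
   its inverse, it yields both hypotheses of [part_restricts_antisym]. *)
have compress (A' B' : tensor F n m l) :
    tensor_iso (reduction A') (reduction B') -> part_restricts B' A'.
  rewrite !reductionE => /gadget_iso_compress[| | | | | | | | | | | | |P [Q [R [bP bQ bR defA]]]] //.
  all: try (by first [exact: emb1_inj | exact: emb2_inj | exact: emb3_inj | exact: incl_inj]).
  all: try (by move=> *; rewrite !card_colour //; lia).
    by move=> a b; rewrite !card_colour //; have := ltn_ord a; lia.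
  exists P, Q, R; split=> //.
  - by move=> u u' ne; apply: bP; rewrite !colour_incl.
  - by move=> u u' ne; apply: bQ; rewrite !colour_incl.
  - by move=> u u' ne; apply: bR; rewrite !colour_incl.
split=> [|iso]; last first.
  by apply: part_restricts_antisym; apply: compress => //; apply: tensor_iso_sym.
case=> [P [Q [R [uP uQ uR defB]]]]; rewrite !reductionE.
apply: (gadget_iso_lift _ _ _ _ _ _ _ _ _ _ _ _ defB); try exact: mxdiag_unit.
all: try (by first [exact: emb1_inj | exact: emb2_inj | exact: emb3_inj | exact: incl_inj]).
all: by move=> u u'; rewrite !colour_incl; apply: block_diag_mxdiag.
Qed.

End Layout.

(** * Polynomial bounds for the machine *)

Section PowerBounds.
Local Open Scope nat_scope.
Variable X : nat.
Hypothesis X_ge2 : 2 <= X.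

(** All quantities are bounded by powers of a common [X >= 2], so that constants are absorbed by
    raising the exponent. *)
Lemma leq_powD a b i j : a <= X ^ i -> b <= X ^ j -> a + b <= X ^ (i + j).+1.
Proof.
move=> ai bj; have Xi : 0 < X ^ i by rewrite expn_gt0; lia.
have Xj : 0 < X ^ j by rewrite expn_gt0; lia.
rewrite expnS expnD; apply: leq_trans (leq_mul X_ge2 (leqnn _)).
case: (X ^ i) (X ^ j) Xi Xj ai bj => [|x] [|y] //; nia.
Qed.

Lemma leq_powM a b i j : a <= X ^ i -> b <= X ^ j -> a * b <= X ^ (i + j).
Proof. by move=> ai bj; rewrite expnD leq_mul. Qed.

Lemma leq_powS a i : a <= X ^ i -> a.+1 <= X ^ i.+1.
Proof.
move=> ai; have Xi : 0 < X ^ i by rewrite expn_gt0; lia.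
rewrite expnS; apply: leq_trans (leq_mul X_ge2 (leqnn _)); lia.
Qed.

Lemma leq_powW a i j : i <= j -> a <= X ^ i -> a <= X ^ j.
Proof. by move=> ij ai; rewrite (leq_trans ai) // leq_pexp2l //; lia. Qed.

Lemma leq_pow1 a i : a <= X -> a <= X ^ i.+1.
Proof. by move=> aX; apply: (@leq_powW _ 1) => //; rewrite expn1. Qed.

End PowerBounds.

Section Machine.
Variables (F : fieldType) (sz : F -> nat).
Implicit Types (s : state F) (X k : nat).

(** Constants up to 2 lie below every admissible [X]. *)
Fixpoint iok (e : iexp) : bool :=
  match e with
  | IConst c => (c <= 2)%N
  | IReg _ => true
  | ILoad e => iok e
  | IAdd e1 e2 | ISub e1 e2 | IMul e1 e2 | IDiv e1 e2 | IMod e1 e2 => iok e1 && iok e2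
  end.

(** Field elements are only copied or set to 0 or 1, since nothing is known about the behaviour of
    [sz] under field operations. *)
Definition fok (e : fexp F) : bool :=
  match e with
  | FConst c => (c == 0) || (c == 1)
  | FLoad e => iok e
  | _ => false
  end.

Fixpoint bok (b : bexp F) : bool :=
  match b with
  | BIle e1 e2 | BIeq e1 e2 => iok e1 && iok e2
  | BFeq _ _ => false
  | BNot b => bok b
  | BAnd b1 b2 => bok b1 && bok b2
  end.

Fixpoint loopfree (c : cmd F) : bool :=
  match c with
  | Skip => true
  | SetReg _ e => iok e
  | IStore _ _ => false
  | FStore a e => iok a && fok e
  | Seq c1 c2 => loopfree c1 && loopfree c2
  | If b c1 c2 => [&& bok b, loopfree c1 & loopfree c2]
  | While _ _ => false
  end.

(* Junk value on [IStore] and [While], which are not [loopfree]. *)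
Fixpoint run (c : cmd F) s : state F :=
  match c with
  | SetReg x e => set_reg s x (ieval s e)
  | FStore a e => set_fmem s (ieval s a) (feval s e)
  | Seq c1 c2 => run c2 (run c1 s)
  | If b c1 c2 => if beval s b then run c1 s else run c2 s
  | _ => s
  end.

Definition bounded X s :=
  [/\ (2 <= X)%N /\ (sz 0 <= X)%N /\ (sz 1 <= X)%N, forall x, (reg s x <= X)%N,
      forall a, (imem s a <= X)%N & forall a, (sz (fmem s a) <= X)%N].

Lemma boundedW X Y s : (X <= Y)%N -> bounded X s -> bounded Y s.
Proof.
move=> XY [[X2 [X0 X1]] rX iX fX].
by split=> [|x|a|a]; try split; rewrite ?(leq_trans _ XY) //; split; apply: leq_trans XY.
Qed.

Lemma bounded_pow X k s : bounded X s -> bounded (X ^ k.+1) s.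
Proof.
move=> bX; have [[X2 _] _ _ _] := bX; apply: boundedW bX.
exact: leq_pow1.
Qed.

Lemma bits_leS n : (bits n <= n.+1)%N.
Proof.
rewrite ltnS; case: n => // n; apply: ltnW.
exact: leq_trans (ltn_expl _ (isT : (1 < 2)%N)) (trunc_logP _ _).
Qed.

(** The exponent depends on the expression alone and not on the state or on [X]; the bounds below
    keep this order of quantifiers. *)
Lemma ieval_bound e : iok e ->
  exists k, forall X s, bounded X s -> (ieval s e <= X ^ k.+1)%N.
Proof.
elim: e => /= [c c2|x _|e IH|e1 IH1 e2 IH2|e1 IH1 e2 IH2|e1 IH1 e2 IH2|e1 IH1 e2 IH2|e1 IH1 e2 IH2].
- by exists 0%N => X s [[X2 _] _ _ _]; rewrite expn1 (leq_trans c2).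
- by exists 0%N => X s [_ rX _ _]; rewrite expn1.
- by exists 0%N => X s [_ _ iX _]; rewrite expn1.
- case/andP=> /IH1[k1 H1] /IH2[k2 H2]; exists (k1.+1 + k2.+1)%N => X s bX.
  by have [[X2 _] _ _ _] := bX; apply: leq_powD; [|apply: H1|apply: H2].
- case/andP=> /IH1[k1 H1] _; exists k1 => X s /H1; apply: leq_trans; exact: leq_subr.
- case/andP=> /IH1[k1 H1] /IH2[k2 H2]; exists (k1 + k2.+1)%N => X s bX.
  by rewrite -addSn; apply: leq_powM; [apply: H1|apply: H2].
- case/andP=> /IH1[k1 H1] _; exists k1 => X s /H1; apply: leq_trans; exact: leq_div.
- case/andP=> /IH1[k1 H1] _; exists k1 => X s /H1; apply: leq_trans; exact: leq_mod.
Qed.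

Lemma icost_bound e : iok e ->
  exists k, forall X s, bounded X s -> (icost s e <= X ^ k.+1)%N.
Proof.
have node e' : iok e' -> exists k, forall X s, bounded X s ->
    (bits (ieval s e') <= X ^ k.+1)%N.
  move=> /ieval_bound[k H]; exists k.+1 => X s bX; have [[X2 _] _ _ _] := bX.
  by apply: leq_trans (bits_leS _) _; apply: leq_powS (H _ _ bX).
elim: e => [c|x|e IH|e1 IH1 e2 IH2|e1 IH1 e2 IH2|e1 IH1 e2 IH2|e1 IH1 e2 IH2|e1 IH1 e2 IH2] ok.
1,2: by have [k H] := node _ ok; exists k => X s bX; rewrite /= addn0; apply: (H X s bX).
  have [k H] := node _ ok; have [k1 H1] := IH ok.
  exists (k.+1 + k1.+1)%N => X s bX; have [[X2 _] _ _ _] := bX.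
  by apply: leq_powD (H X s bX) (H1 X s bX).
all: have [k H] := node _ ok; case/andP: ok => /IH1[k1 H1] /IH2[k2 H2].
all: exists (k.+1 + (k1.+1 + k2.+1).+1)%N => X s bX; have [[X2 _] _ _ _] := bX.
all: by apply: (leq_powD X2 (H X s bX)); apply: (leq_powD X2); [apply: H1|apply: H2].
Qed.

Lemma fcost_bound e : fok e ->
  exists k, forall X s, bounded X s -> (fcost sz s e <= X ^ k.+1)%N /\ (sz (feval s e) <= X)%N.
Proof.
case: e => //= [c c01|e /icost_bound[k H]].
  exists 1%N => X s [[X2 [X0 X1]] _ _ _].
  have cX : (sz c <= X)%N by case/orP: c01 => /eqP ->.
  by split=> //; rewrite addn0; apply: leq_powS => //; rewrite expn1.
exists (2 + k.+1)%N => X s bX; have [[X2 _] _ _ fX] := bX; split=> //.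
by apply: leq_powD (H X s bX) => //; apply: leq_powS => //; rewrite expn1.
Qed.

Lemma bcost_bound b : bok b ->
  exists k, forall X s, bounded X s -> (bcost sz s b <= X ^ k.+1)%N.
Proof.
elim: b => //= [e1 e2|e1 e2|b IH|b1 IH1 b2 IH2].
1,2: case/andP=> /icost_bound[k1 H1] /icost_bound[k2 H2].
1,2: exists (k1.+1 + k2.+1).+1 => X s bX; have [[X2 _] _ _ _] := bX; rewrite add1n.
1,2: by apply: leq_powS => //; apply: leq_powD (H1 _ _ bX) (H2 _ _ bX).
- move=> /IH[k H]; exists k.+1 => X s bX; have [[X2 _] _ _ _] := bX; rewrite add1n.
  by apply: leq_powS (H _ _ bX).
- case/andP=> /IH1[k1 H1] /IH2[k2 H2].
  exists (k1.+1 + k2.+1).+1 => X s bX; have [[X2 _] _ _ _] := bX; rewrite add1n.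
  by apply: leq_powS => //; apply: leq_powD (H1 _ _ bX) (H2 _ _ bX).
Qed.

Lemma bounded_set_reg X s x v : bounded X s -> (v <= X)%N -> bounded X (set_reg s x v).
Proof.
by move=> [X2 rX iX fX] vX; split=> //= y; case: eqP.
Qed.

Lemma bounded_set_fmem X s a v : bounded X s -> (sz v <= X)%N -> bounded X (set_fmem s a v).
Proof.
by move=> [X2 rX iX fX] vX; split=> //= y; case: eqP.
Qed.

Definition terminates c s T (Q : state F -> Prop) :=
  exists s' t, [/\ exec sz c s s' t, (t <= T)%N & Q s'].

Lemma loopfree_exec c : loopfree c ->
  exists k, forall X s, bounded X s ->
    exists2 t, exec sz c s (run c s) t & (t <= X ^ k.+1)%N /\ bounded (X ^ k.+1) (run c s).
Proof.
elim: c => //= [_|x e ok|a e /andP[oka oke]|c1 IH1 c2 IH2 /andP[/IH1[k1 H1] /IH2[k2 H2]]|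
                b c1 IH1 c2 IH2 /and3P[/bcost_bound[k H] /IH1[k1 H1] /IH2[k2 H2]]].
- exists 0%N => X s bX; exists 1%N; first exact: ExecSkip.
  by have [[X2 _] _ _ _] := bX; rewrite expn1; split=> //; lia.
- have [k1 H1] := icost_bound ok; have [k2 H2] := ieval_bound ok.
  exists (k1.+1 + k2)%N => X s bX; have [[X2 _] _ _ _] := bX.
  exists (icost s e).+1; first exact: ExecSetReg.
  split; first by apply: (@leq_powW X X2 _ k1.+2); [lia | apply: leq_powS (H1 _ _ bX)].
  apply: bounded_set_reg; first exact: bounded_pow.
  by apply: leq_powW (H2 _ _ bX) => //; lia.
- have [k1 H1] := icost_bound oka; have [k2 H2] := fcost_bound oke.
  exists (k1.+1 + k2.+1).+1 => X s bX; have [[X2 _] _ _ _] := bX.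
  have [H3 H4] := H2 _ _ bX.
  exists (icost s a + fcost sz s e).+1; first exact: ExecFStore.
  split; first by apply: leq_powS => //; apply: leq_powD (H1 _ _ bX) H3.
  apply: bounded_set_fmem; first exact: bounded_pow.
  exact: leq_pow1.
(* The second command starts from a state bounded by a power of [X], so the exponents multiply. *)
- exists (k1.+1 + k1.+1 * k2.+1).+1 => X s bX; have [[X2 _] _ _ _] := bX.
  have [t1 ex1 [le1 b1]] := H1 _ _ bX; have [t2 ex2 [le2 b2]] := H2 _ _ b1.
  rewrite -expnM in le2 b2.
  exists (t1 + t2).+1; first exact: ExecSeq ex1 ex2.
  split; first by apply: leq_powS => //; apply: leq_powD le1 le2.
  by apply: boundedW b2; rewrite leq_pexp2l //; lia.
exists (k.+1 + (k1.+1 + k2.+1)).+1 => X s bX; have [[X2 _] _ _ _] := bX.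
have [t ex [le bt]] : exists2 t,
    exec sz (if beval s b then c1 else c2) s (if beval s b then run c1 s else run c2 s) t &
    (t <= X ^ (k1.+1 + k2.+1))%N /\
    bounded (X ^ (k1.+1 + k2.+1)) (if beval s b then run c1 s else run c2 s).
  case: (beval s b); [have [t ex [le bt]] := H1 _ _ bX|have [t ex [le bt]] := H2 _ _ bX];
    by exists t => //; split; [apply: leq_powW le => //; lia |
      apply: boundedW bt; rewrite leq_pexp2l //; lia].
exists (bcost sz s b + t).+1; first exact: ExecIf.
split; first by apply: leq_powS => //; apply: leq_powD (H _ _ bX) le.
by apply: boundedW bt; rewrite leq_pexp2l //; lia.
Qed.

(** There are [n] bodies and [n + 1] tests, each of cost at most [T], and one unit per test. *)
Lemma while_exec b c (Inv : nat -> state F -> Prop) n T s :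
  Inv 0%N s ->
  (forall i s', (i <= n)%N -> Inv i s' -> (bcost sz s' b <= T)%N /\ beval s' b = (i < n)%N) ->
  (forall i s', (i < n)%N -> Inv i s' -> terminates c s' T (Inv i.+1)) ->
  terminates (While b c) s (n.+1 * (T + T).+1) (Inv n).
Proof.
move=> I0 Hb Hc.
suff gen k : forall i s', (i + k = n)%N -> Inv i s' ->
    terminates (While b c) s' (k.+1 * (T + T).+1) (Inv n).
  exact: (gen n 0%N).
elim: k => [|k IH] i s' eqn Ii.
  have {}eqn : i = n by lia.
  subst i; have [leb bE] := Hb _ _ (leqnn n) Ii.
  exists s', (bcost sz s' b).+1; split=> //; last by lia.
  by apply: ExecWhileStop; rewrite bE ltnn.
have lti : (i < n)%N by lia.
have [leb bE] := Hb _ _ (ltnW lti) Ii; have [s1 [t1 [ex1 le1 I1]]] := Hc _ _ lti Ii.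
have [|s2 [t2 [ex2 le2 I2]]] := IH i.+1 s1 _ I1; first by lia.
exists s2, (bcost sz s' b + t1 + t2).+1; split=> //; last by nia.
by apply: ExecWhileStep ex1 ex2; rewrite bE.
Qed.

End Machine.

(** * Triples for total correctness in polynomial time *)

Section Triples.
Variables (F : fieldType) (sz : F -> nat).
Implicit Types (s : state F) (c : cmd F) (X k : nat).

(* Total correctness in time polynomial in any bound [X] on the initial state
   and on the size [mu g] of the ghost parameter [g]. *)
Definition triple (G : Type) (mu : G -> nat) (P : G -> state F -> Prop) c
    (Q : G -> state F -> Prop) :=
  exists k, forall g X s, bounded sz X s -> (mu g <= X)%N -> P g s ->
    terminates sz c s (X ^ k.+1) (fun s' => Q g s' /\ bounded sz (X ^ k.+1) s').

Section Rules.
Variables (G : Type) (mu : G -> nat).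
Implicit Types (P Q : G -> state F -> Prop).

Lemma triple_seq P Q R c1 c2 :
  triple mu P c1 Q -> triple mu Q c2 R -> triple mu P (Seq c1 c2) R.
Proof.
move=> [k1 H1] [k2 H2]; exists (k1.+1 + k1.+1 * k2.+1).+1 => g X s bX gX Ps.
have [[X2 _] _ _ _] := bX.
have [s1 [t1 [ex1 le1 [Q1 b1]]]] := H1 g X s bX gX Ps.
have gX1 : (mu g <= X ^ k1.+1)%N by apply: leq_pow1.
have [s2 [t2 [ex2 le2 [Q2 b2]]]] := H2 g _ s1 b1 gX1 Q1.
rewrite -expnM in le2 b2.
exists s2, (t1 + t2).+1; split; first exact: ExecSeq ex1 ex2.
  by apply: leq_powS => //; apply: leq_powD le1 le2.
by split=> //; apply: boundedW b2; rewrite leq_pexp2l //; lia.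
Qed.

Lemma triple_loopfree P Q c : loopfree c ->
  (forall g s, P g s -> Q g (run c s)) -> triple mu P c Q.
Proof.
move=> /(loopfree_exec sz)[k H] PQ; exists k => g X s bX gX Ps.
have [t ex [le bt]] := H X s bX; exists (run c s), t; split=> //; split=> //.
exact: PQ.
Qed.

(** Composing the bound of the body with itself would multiply exponents at every round. Therefore
    the invariant, which refers to the state [s0] at loop entry, must itself bound all intermediate
    states by one power of [X]. *)
Lemma triple_while P Q b c (Inv : state F -> nat -> state F -> Prop)
    (cnt : state F -> nat) :
  bok b ->
  triple (fun=> 0%N) (fun g s => (g.2 < cnt g.1)%N /\ Inv g.1 g.2 s) c
    (fun g s => Inv g.1 g.2.+1 s) ->
  (exists k, forall g X s0, bounded sz X s0 -> (mu g <= X)%N -> P g s0 ->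
    [/\ Inv s0 0%N s0, (cnt s0 <= X ^ k.+1)%N &
        forall i s, (i <= cnt s0)%N -> Inv s0 i s ->
          bounded sz (X ^ k.+1) s /\ beval s b = (i < cnt s0)%N]) ->
  (forall g s0 s, P g s0 -> Inv s0 (cnt s0) s -> Q g s) ->
  triple mu P (While b c) Q.
Proof.
move=> /(bcost_bound sz)[kb Hb] [kc Hc] [k H] PQ.
pose e := (k.+1 * (kb.+1 + kc.+1))%N.
exists (k.+1 + ((e + e).+1).+1)%N => g X s0 bX gX Ps0; have [[X2 _] _ _ _] := bX.
have [I0 cntX HI] := H g X s0 bX gX Ps0.
have Y2 : (2 <= X ^ k.+1)%N by apply: leq_pow1.
have eE : (X ^ e = (X ^ k.+1) ^ (kb.+1 + kc.+1))%N by rewrite expnM.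
have [||s' [t [ex le Is']]] := @while_exec _ sz b c (Inv s0) (cnt s0) (X ^ e) s0 I0.
- move=> i s lei Ii; have [bs bE] := HI i s lei Ii; split=> //.
  by rewrite eE; apply: leq_powW (Hb _ _ bs) => //; lia.
- move=> i s lti Ii; have [bs bE] := HI i s (ltnW lti) Ii.
  have [s1 [t1 [ex1 le1 [I1 _]]]] := Hc (s0, i) _ s bs (leq0n _) (conj lti Ii).
  exists s1, t1; split=> //; rewrite eE; apply: leq_powW le1 => //; lia.
exists s', t; split=> //.
  apply: leq_trans le _; rewrite -[in leqRHS]addSn; apply: leq_powM; first exact: leq_powS.
  by apply: leq_powS => //; apply: leq_powD.
split; first exact: PQ Is'.
have [bs' _] := HI _ s' (leqnn _) Is'.
by apply: boundedW bs'; rewrite leq_pexp2l //; lia.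
Qed.

End Rules.

Definition frame (l : seq nat) s s' :=
  (forall x, x \notin l -> reg s' x = reg s x) /\ imem s' = imem s.

Lemma frame_trans l s1 s2 s3 : frame l s1 s2 -> frame l s2 s3 -> frame l s1 s3.
Proof.
move=> [r12 i12] [r23 i23]; split=> [x lx|]; last by rewrite i23.
by rewrite r23 // r12.
Qed.

Lemma bounded_frame X l s s' : bounded sz X s -> frame l s s' ->
  (forall x, x \in l -> (reg s' x <= X)%N) -> (forall a, (sz (fmem s' a) <= X)%N) ->
  bounded sz X s'.
Proof.
move=> [X2 rX iX fX] [fr im] lX f'X; split=> // [x|a]; last by rewrite im.
by case: (boolP (x \in l)) => [/lX //|/fr ->].
Qed.

Definition lt_exp (e1 e2 : iexp) : bexp F := BIle F (IAdd e1 (IConst 1)) e2.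

(* Registers: 0-2 hold the numbers of blocks, 3-5 the input dimensions, 6-8 the
   powers 2^N, 2^M, 2^L, 9-11 the padded dimensions, 12-14 the output dimensions,
   15 the copying index, 16-21 arguments and results of [scan] and [fill], 22-24
   counters. *)
Definition scan : cmd F :=
  Seq (Seq (SetReg 18 (IConst 0)) (Seq (SetReg 19 (IConst 1)) (SetReg 22 (IConst 0))))
      (While (lt_exp (IReg 22) (IReg 17))
        (Seq (SetReg 18 (IAdd (IReg 18) (ILoad (IAdd (IReg 16) (IReg 22)))))
        (Seq (SetReg 19 (IAdd (IReg 19) (IReg 19)))
             (SetReg 22 (IAdd (IReg 22) (IConst 1)))))).

Definition seg_sum s i := (\sum_(a < i) imem s (reg s 16 + a))%N.

(** A single pass gives the sum of a segment and, by doubling, the power of 2 of its length.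
    Intermediate values stay below the final ones, which [mu] bounds. *)
Lemma scan_triple (G : Type) (mu : G -> nat) (P Q : G -> state F -> Prop) :
  (forall g s, P g s -> (2 ^ reg s 17 <= mu g)%N /\ (seg_sum s (reg s 17) <= mu g)%N) ->
  (forall g s s', P g s -> frame [:: 18; 19; 22] s s' -> fmem s' = fmem s ->
     reg s' 18 = seg_sum s (reg s 17) -> reg s' 19 = (2 ^ reg s 17)%N -> Q g s') ->
  triple mu P scan Q.
Proof.
move=> Pmu PQ.
pose mid g s1 := exists2 s, P g s /\ fmem s1 = fmem s &
  frame [:: 18; 19; 22] s s1 /\ [/\ reg s1 18 = 0, reg s1 19 = 1 & reg s1 22 = 0]%N.
apply: (triple_seq (Q := mid)).
  apply: triple_loopfree => // g s Ps; exists s => //; split=> //; split=> // x.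
  by rewrite !inE !negb_or => /and3P[/negbTE x18 /negbTE x19 /negbTE x22] /=; rewrite x18 x19 x22.
pose Inv s0 i s := [/\ frame [:: 18; 19; 22] s0 s, fmem s = fmem s0,
  reg s 18 = seg_sum s0 i, reg s 19 = (2 ^ i)%N & reg s 22 = i].
have sum_frame s s1 i : frame [:: 18; 19; 22] s s1 -> seg_sum s1 i = seg_sum s i.
  by move=> [fr im]; apply: eq_bigr => a _; rewrite im fr.
have sum_mono s i j : (i <= j)%N -> (seg_sum s i <= seg_sum s j)%N.
  move=> leij; rewrite /seg_sum -!(big_mkord xpredT (fun a => imem s (reg s 16 + a))).
  by rewrite (@big_cat_nat _ _ _ i 0 j) //= leq_addr.
apply: (@triple_while _ _ _ _ _ _ Inv (fun s => reg s 17)) => //.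
- apply: triple_loopfree => // [[s0 i]] s /= [lti [fr fm r18 r19 r22]].
  split=> //=.
  + have [fr1 im1] := fr; split=> // x; rewrite !inE !negb_or => /and3P[x18 x19 x22] /=.
    by rewrite (negbTE x18) (negbTE x19) (negbTE x22) fr1 // !inE !negb_or x18 x19.
  + by have [fr1 im1] := fr; rewrite /seg_sum big_ord_recr /= r18 r22 im1 fr1.
  + by rewrite r19 expnS; lia.
  + by rewrite r22 addn1.
- exists 0%N => g X s0 bX gX [s [Ps fm] [fr [r18 r19 r22]]]; rewrite expn1.
  have [pow_le sum_le] := Pmu g s Ps.
  have r17 : reg s0 17 = reg s 17 by apply: fr.1.
  have [X2 rX iX fX] := bX.
  split=> // [|i s1 lei [fr1 fm1 r18' r19' r22']].
    by split=> //; rewrite r18 /seg_sum big_ord0.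
  split; last by rewrite /= r22' addn1 fr1.1.
  apply: bounded_frame bX fr1 _ _ => [x|a]; last by rewrite fm1.
  rewrite !inE => /or3P[] /eqP ->; rewrite ?r18' ?r19' ?r22'.
  + by rewrite (leq_trans (sum_mono _ _ _ lei)) // (sum_frame _ _ _ fr) r17 (leq_trans sum_le).
  + by rewrite (leq_trans _ (leq_trans pow_le gX)) // leq_pexp2l // -r17.
  + exact: leq_trans lei (rX 17).
- move=> g s0 s [s1 [Ps fm] [fr [r18 r19 r22]]] [fr1 fm1 r18' r19' r22'].
  have r17 : reg s0 17 = reg s1 17 by apply: fr.1.
  apply: (PQ g s1) => //.
  + exact: frame_trans fr fr1.
  + by rewrite fm1.
  + by rewrite r18' (sum_frame _ _ _ fr) r17.
  + by rewrite r19' r17.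
Qed.

(** Flat addresses of ones: an affine form in the position [c] and its colour [a]. *)
Fixpoint stamps (al be ga c : nat) (cs : seq nat) : seq nat :=
  if cs is a :: cs' then (al * c + be * a + ga)%N :: stamps al be ga c.+1 cs' else [::].

Lemma stamps_cat al be ga (c : nat) cs cs' :
  stamps al be ga c (cs ++ cs') = stamps al be ga c cs ++ stamps al be ga (c + size cs) cs'.
Proof.
elim: cs c => [|a cs IH] c; first by rewrite addn0.
by rewrite /= IH addSnnS.
Qed.

Definition mark (l : seq nat) (f : nat -> F) (x : nat) : F := if x \in l then 1 else f x.

Lemma mark_cat l l' f : mark (l ++ l') f =1 mark l' (mark l f).
Proof. by move=> x; rewrite /mark mem_cat orbC; case: (x \in l') => //. Qed.

Lemma eq_mark l f g : f =1 g -> mark l f =1 mark l g.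
Proof. by move=> fg x; rewrite /mark fg. Qed.

Lemma mark1 a f : mark [:: a] f =1 [eta f with a |-> 1].
Proof. by move=> x; rewrite /mark /= inE. Qed.

Definition fill_step : cmd F :=
  Seq (FStore (IAdd (IAdd (IMul (IReg 19) (IReg 24)) (IMul (IReg 20) (IReg 22))) (IReg 21))
              (FConst 1))
  (Seq (SetReg 24 (IAdd (IReg 24) (IConst 1))) (SetReg 23 (IAdd (IReg 23) (IConst 1)))).

(** Register 22 numbers the runs and 24 the positions. Register 24 is not reset, so two successive
    fills treat a concatenation of runs, as in [colours]. *)
Definition fill (e : iexp) : cmd F :=
  Seq (SetReg 22 (IConst 0))
      (While (lt_exp (IReg 22) (IReg 17))
        (Seq (SetReg 23 (IConst 0))
        (Seq (While (lt_exp (IReg 23) e) fill_step)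
             (SetReg 22 (IAdd (IReg 22) (IConst 1)))))).

Section Fill.
(** [f] records that the run length depends only on [imem] and the registers 16, 18 and 22, none of
    which the inner loop changes. *)
Variables (e : iexp) (f : (nat -> nat) -> nat -> nat -> nat -> nat).
Hypothesis e_ok : iok e.
Hypothesis eE : forall s, ieval s e = f (imem s) (reg s 16) (reg s 18) (reg s 22).

Definition run_length s a := f (imem s) (reg s 16) (reg s 18) a.
Definition stamp_list s cs := stamps (reg s 19) (reg s 20) (reg s 21) (reg s 24) cs.

Lemma sz_mark X s l : bounded sz X s -> forall a, (sz (mark l (fmem s) a) <= X)%N.
Proof. by move=> [[_ [_ X1]] _ _ fX] a; rewrite /mark; case: ifP. Qed.

Lemma inner_triple (G : Type) (mu : G -> nat) (P Q : G -> state F -> Prop) :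
  (forall g s, P g s -> reg s 23 = 0%N) ->
  (forall g s s', P g s -> frame [:: 23; 24] s s' ->
     reg s' 23 = run_length s (reg s 22) -> reg s' 24 = (reg s 24 + run_length s (reg s 22))%N ->
     fmem s' =1 mark (stamp_list s (nseq (run_length s (reg s 22)) (reg s 22))) (fmem s) ->
     Q g s') ->
  triple mu P (While (lt_exp (IReg 23) e) fill_step) Q.
Proof.
move=> P23 PQ.
pose Inv s0 i s := [/\ frame [:: 23; 24] s0 s, reg s 23 = i, reg s 24 = (reg s0 24 + i)%N &
  fmem s =1 mark (stamp_list s0 (nseq i (reg s0 22))) (fmem s0)].
apply: (@triple_while _ _ _ _ _ _ Inv (fun s => run_length s (reg s 22))) => //=.
- apply: triple_loopfree => /= [|[s0 i] s /= [lti [fr r23 r24 fm]]]; first by rewrite eqxx orbT.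
  have [fr1 im1] := fr.
  split=> /=; rewrite ?r23 ?r24 ?addn1 ?addnS //.
  + split=> // x; rewrite !inE !negb_or => /andP[x23 x24] /=.
    by rewrite (negbTE x23) (negbTE x24) fr1 // !inE !negb_or x23.
  + move=> x; rewrite -[RHS]/(mark (stamp_list s0 (nseq i.+1 (reg s0 22))) (fmem s0) x).
    rewrite -[i.+1]addn1 nseqD /stamp_list stamps_cat mark_cat size_nseq /= mark1 /=.
    by rewrite !fr1 // fm.
- have [k H] := ieval_bound sz e_ok; exists k.+2 => g X s0 bX gX Ps0.
  have [[X2 _] rX iX fX] := bX.
  have cntX : (run_length s0 (reg s0 22) <= X ^ k.+1)%N by have := H X s0 bX; rewrite eE.
  split=> [||i s lei [fr r23 r24 fm]].
  + by split=> //; rewrite ?addn0 ?(P23 g).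
  + by apply: leq_powW cntX; lia.
  split; last by have [fr1 im1] := fr; rewrite /= eE r23 addn1 im1 !fr1.
  apply: bounded_frame (bounded_pow _ bX) fr _ _ => [x|a]; last first.
    by rewrite fm; apply: sz_mark (bounded_pow _ bX) _.
  rewrite !inE => /orP[] /eqP ->; rewrite ?r23 ?r24.
    by apply: (leq_powW X2 (i := k.+1)); [lia | apply: leq_trans lei cntX].
  have iX' := leq_trans lei cntX.
  have : (reg s0 24 <= X ^ 1)%N by rewrite expn1.
  by move=> /(leq_powD X2)/(_ iX'); rewrite add1n.
move=> g s0 s Ps0 [fr r23 r24 fm]; exact: PQ Ps0 fr r23 r24 fm.
Qed.

Lemma fill_triple (G : Type) (mu : G -> nat) (P Q : G -> state F -> Prop) :
  (forall g s s', P g s -> frame [:: 22; 23; 24] s s' ->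
     reg s' 24 = (reg s 24 + size (runs (run_length s) (reg s 17)))%N ->
     fmem s' =1 mark (stamp_list s (runs (run_length s) (reg s 17))) (fmem s) ->
     Q g s') ->
  triple mu P (fill e) Q.
Proof.
move=> PQ.
pose mid g s1 := exists2 s, P g s & s1 = set_reg s 22 0%N.
apply: (triple_seq (Q := mid)).
  by apply: triple_loopfree => // g s Ps; exists s.
(* Register 23 keeps the length of the last run, so only a bound on it is carried along. *)
pose Inv s0 i s := [/\ frame [:: 22; 23; 24] s0 s, reg s 22 = i,
  (reg s 23 <= reg s0 23 + size (runs (run_length s0) i))%N,
  reg s 24 = (reg s0 24 + size (runs (run_length s0) i))%N &
  fmem s =1 mark (stamp_list s0 (runs (run_length s0) i)) (fmem s0)].
apply: (@triple_while _ _ _ _ _ _ Inv (fun s => reg s 17)) => //.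
- pose mid1 (g : state F * nat) s := (g.2 < reg g.1 17)%N /\
    exists2 s1, Inv g.1 g.2 s1 & s = set_reg s1 23 0%N.
  pose mid2 (g : state F * nat) s := exists2 s1, Inv g.1 g.2 s1 &
    [/\ frame [:: 23; 24] s1 s, reg s 23 = run_length g.1 g.2,
        reg s 24 = (reg s1 24 + run_length g.1 g.2)%N &
        fmem s =1 mark (stamp_list s1 (nseq (run_length g.1 g.2) g.2)) (fmem s1)].
  apply: (triple_seq (Q := mid1)).
    by apply: triple_loopfree => // g s [lti Ii]; split=> //; exists s.
  apply: (triple_seq (Q := mid2)).
    apply: inner_triple => [g s [_ [s1 _ ->]] //|[s0 i] s s' [/= lti [s1 Ii sE]]].
    have [[fr1 im1] r22 r23 r24 fm] := Ii.
    have rl : run_length s (reg s 22) = run_length s0 i.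
      by rewrite sE /run_length /= r22 im1 !fr1.
    rewrite rl => fr r23' r24' fm'; exists s1; first exact: Ii.
    split=> //.
    + have [fr2 im2] := fr; split=> [x xl|]; last by rewrite im2 sE.
      by rewrite fr2 // sE /=; move: xl; rewrite !inE !negb_or => /andP[/negbTE ->].
    + by rewrite r24' sE.
    + by move=> x; rewrite fm' sE /= r22.
  apply: triple_loopfree => // [[s0 i]] s /= [s1 Ii [fr' r23' r24' fm']].
  have [[fr1 im1] r22 r23 r24 fm] := Ii; have [fr2 im2] := fr'.
  have r22s : reg s 22 = i by rewrite fr2.
  split=> /=; rewrite ?r22s ?addn1 ?runsS ?size_cat ?size_nseq //.
  + split=> [x|]; last by rewrite /= im2.
    rewrite !inE !negb_or => /and3P[x22 x23 x24] /=.
    by rewrite (negbTE x22) fr2 ?fr1 // !inE !negb_or ?x22 ?x23 ?x24.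
  + by rewrite r23' /=; lia.
  + by rewrite r24' r24 addnA.
  + move=> x; rewrite fm' /stamp_list stamps_cat mark_cat r24 !fr1 //.
    exact: eq_mark.
- have [k H] := ieval_bound sz e_ok.
  exists k.+3 => g X s0 bX gX [s Ps s0E].
  have [[X2 _] rX iX fX] := bX.
  have cntX : (reg s0 17 <= X ^ k.+4)%N by apply: leq_pow1.
  have sizeX i : (i <= reg s0 17)%N -> (size (runs (run_length s0) i) <= X ^ k.+2)%N.
    move=> lei; rewrite size_runs expnS.
    apply: (@leq_trans (i * X ^ k.+1)); last by rewrite leq_mul ?(leq_trans lei).
    rewrite -[X in (_ <= X * _)%N]card_ord -sum_nat_const; apply: leq_sum => a _.
    have ba : bounded sz X (set_reg s0 22 a).
      apply: bounded_set_reg => //; apply: leq_trans (rX 17).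
      exact: ltnW (leq_trans (ltn_ord a) lei).
    by have := H _ _ ba; rewrite eE.
  split=> // [|i s1 lei [fr r22 r23 r24 fm]].
    by split; rewrite ?s0E ?addn0 // /runs /=; lia.
  split; last by have [fr1 im1] := fr; rewrite /= r22 addn1 fr1.
  have regX x : (reg s0 x + size (runs (run_length s0) i) <= X ^ k.+4)%N.
    have : (reg s0 x <= X ^ 1)%N by rewrite expn1.
    by move=> /(leq_powD X2)/(_ (sizeX i lei)); rewrite add1n.
  apply: bounded_frame (bounded_pow _ bX) fr _ _ => [x|a]; last first.
    by rewrite fm; apply: sz_mark (bounded_pow _ bX) _.
  rewrite !inE => /or3P[] /eqP ->; rewrite ?r22 ?r24 //.
    exact: leq_trans lei _.
  exact: leq_trans r23 _.
move=> g s0 s [s1 Ps s0E] [fr r22 r23 r24 fm]; apply: (PQ g s1) => //.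
- have [fr1 im1] := fr; split=> [x xl|]; last by rewrite im1 s0E.
  by rewrite fr1 // s0E /=; move: xl; rewrite inE negb_or => /andP[/negbTE ->].
- by rewrite r24 s0E.
- by move=> x; rewrite fm s0E.
Qed.

End Fill.

End Triples.

(** * Flat addresses and lists of entries *)

Section MixedRadix.
Local Open Scope nat_scope.

Lemma radix3_div m l i j k : j < m -> k < l ->
  [/\ ((i * m + j) * l + k) %/ l %/ m = i, ((i * m + j) * l + k) %/ l %% m = j &
      ((i * m + j) * l + k) %% l = k].
Proof.
move=> ltj ltk; have l_gt0 : 0 < l by lia.
have m_gt0 : 0 < m by lia.
rewrite (divnMDl _ _ l_gt0) (divn_small ltk) addn0 (divnMDl _ _ m_gt0) (divn_small ltj) addn0.
by rewrite !modnMDl !modn_small.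
Qed.

Lemma radix3_inj m l i j k i' j' k' : j < m -> k < l -> j' < m -> k' < l ->
  (i * m + j) * l + k = (i' * m + j') * l + k' -> [/\ i = i', j = j' & k = k'].
Proof.
move=> ltj ltk ltj' ltk' e.
have [iE jE kE] := radix3_div i ltj ltk; have [iE' jE' kE'] := radix3_div i' ltj' ltk'.
by rewrite -e in iE' jE' kE'; split; congruence.
Qed.

Lemma radix3_lt n m l i j k : i < n -> j < m -> k < l -> (i * m + j) * l + k < n * m * l.
Proof.
move=> lti ltj ltk; apply: (@leq_trans ((i * m + j).+1 * l)); first by rewrite mulSn; lia.
rewrite leq_mul2r; apply/orP; right.
by apply: (@leq_trans (i.+1 * m)); rewrite ?leq_mul2r ?lti ?orbT // mulSn; lia.
Qed.

End MixedRadix.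

Section Entries.
Variable F : fieldType.

Lemma mkseqM (T : Type) (g : nat -> T) (a b : nat) :
  mkseq g (a * b) = flatten [seq mkseq (fun y => g (x * b + y)%N) b | x <- iota 0 a].
Proof.
elim: a => [|a IH]; first by rewrite mul0n.
rewrite -addn1 mulnDl mul1n iotaD map_cat flatten_cat -IH /= cats0 add0n.
rewrite /mkseq iotaD map_cat add0n; congr (_ ++ _).
by rewrite -[(a * b)%N in LHS]addn0 iotaDl -map_comp.
Qed.

Lemma map_enum_ord (T : Type) (n : nat) (g : nat -> T) :
  [seq g i | i : 'I_n <- enum 'I_n] = mkseq g n.
Proof. by rewrite /mkseq -val_enum_ord -map_comp. Qed.

(** Lexicographic order is the order of the mixed-radix addresses. *)
Lemma entries_mkseq (n m l : nat) (A : tensor F n m l) (g : nat -> F) :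
  (forall (i : 'I_n) (j : 'I_m) (k : 'I_l), g ((i * m + j) * l + k)%N = A (i, j, k)) ->
  entries A = mkseq g (n * m * l).
Proof.
move=> gA; rewrite mkseqM /entries.
have -> : iota 0 (n * m) = [seq (ij.1 * m + ij.2)%N | ij : 'I_n * 'I_m <-
    [seq (i, j) | i <- enum 'I_n, j <- enum 'I_m]].
  rewrite map_flatten -map_comp -[LHS]map_id -/(mkseq id _) mkseqM.
  rewrite -[X in flatten X = _]/(mkseq _ n) -map_enum_ord; congr flatten; apply: eq_map => i /=.
  by rewrite -map_comp -map_enum_ord; apply: eq_map.
rewrite -map_comp; congr flatten; apply: eq_map => [[i j]] /=.
by rewrite -map_enum_ord; apply: eq_map => k; rewrite gA.
Qed.

Lemma nth_entries (n m l : nat) (A : tensor F n m l) (i : 'I_n) (j : 'I_m) (k : 'I_l) :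
  nth 0 (entries A) ((i * m + j) * l + k) = A (i, j, k).
Proof.
pose g x := tensor_get A (x %/ l %/ m) (x %/ l %% m) (x %% l).
have gA (i' : 'I_n) (j' : 'I_m) (k' : 'I_l) : g ((i' * m + j') * l + k')%N = A (i', j', k').
  have [e1 e2 e3] := radix3_div i' (ltn_ord j') (ltn_ord k').
  by rewrite /g e1 e2 e3 /tensor_get !valK.
by rewrite (entries_mkseq gA) nth_mkseq ?gA // radix3_lt.
Qed.

End Entries.

(** * Copying the input into the larger format *)

Section MainLoop.
Variables (F : fieldType) (sz : F -> nat).
Implicit Types (s : state F).

Definition copy_step : cmd F :=
  Seq (SetReg 15 (ISub (IReg 15) (IConst 1)))
  (Seq (SetReg 22 (IDiv (IDiv (IReg 15) (IReg 14)) (IReg 13)))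
  (Seq (SetReg 23 (IMod (IDiv (IReg 15) (IReg 14)) (IReg 13)))
  (Seq (SetReg 24 (IMod (IReg 15) (IReg 14)))
  (If (BAnd (lt_exp F (IReg 22) (IReg 3))
            (BAnd (lt_exp F (IReg 23) (IReg 4)) (lt_exp F (IReg 24) (IReg 5))))
      (FStore (IReg 15) (FLoad F (IAdd (IMul (IAdd (IMul (IReg 22) (IReg 4)) (IReg 23)) (IReg 5))
                                     (IReg 24))))
      (FStore (IReg 15) (FConst 0)))))).

(* Descending order makes the copy safe in place: the source index never exceeds
   the destination index. *)
Definition copy : cmd F := While (lt_exp F (IConst 0) (IReg 15)) copy_step.

Definition copied s (x : nat) : F :=
  let i := (x %/ reg s 14 %/ reg s 13)%N in
  let j := (x %/ reg s 14 %% reg s 13)%N in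
  let k := (x %% reg s 14)%N in
  if [&& i < reg s 3, j < reg s 4 & k < reg s 5]%N
  then fmem s ((i * reg s 4 + j) * reg s 5 + k) else 0.

Lemma run_copy_step s :
  let y := (reg s 15 - 1)%N in
  run copy_step s =
  set_fmem (set_reg (set_reg (set_reg (set_reg s 15 y) 22 (y %/ reg s 14 %/ reg s 13))
                             23 (y %/ reg s 14 %% reg s 13)) 24 (y %% reg s 14))
           y (copied s y).
Proof. by rewrite /copied /= !addn1; case: ifP. Qed.

Lemma copy_triple (G : Type) (mu : G -> nat) (P Q : G -> state F -> Prop) :
  (forall g s, P g s -> (reg s 4 <= reg s 13)%N /\ (reg s 5 <= reg s 14)%N) ->
  (forall g s s', P g s -> frame [:: 15; 22; 23; 24] s s' ->
     (forall x, (x < reg s 15)%N -> fmem s' x = copied s x) -> Q g s') ->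
  triple sz mu P copy Q.
Proof.
move=> Pfit PQ.
(* After [i] rounds the top [i] addresses below [reg s0 15] are final and all others are
   untouched. *)
pose fm s0 i x := if (reg s0 15 - i <= x < reg s0 15)%N then copied s0 x else fmem s0 x.
pose Inv s0 i s := [/\ (reg s0 4 <= reg s0 13)%N /\ (reg s0 5 <= reg s0 14)%N,
  frame [:: 15; 22; 23; 24] s0 s, reg s 15 = (reg s0 15 - i)%N,
  forall x, x \in [:: 22; 23; 24] -> (reg s x <= maxn (reg s0 x) (reg s0 15))%N &
  fmem s =1 fm s0 i].
apply: (@triple_while _ _ _ _ _ _ _ _ Inv (fun s => reg s 15)) => //.
- apply: triple_loopfree => [|[s0 i] s]; first by rewrite /= eqxx.
  rewrite run_copy_step => -[/= lti [fit [fr im] r15 bd fmE]].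
  set y := (reg s 15 - 1)%N.
  have yE : y = (reg s0 15 - i.+1)%N by rewrite /y r15; lia.
  have lty : (y < reg s0 15)%N by lia.
  have copyE : copied s y = copied s0 y.
    rewrite /copied !fr //; case: ifP => // /and3P[_ ltj ltk]; rewrite fmE /fm ifF //.
    (* The source address is at most [y], as the input radices do not exceed the output radices;
       hence it has not been overwritten yet. *)
    apply/negbTE/negP => /andP[le_src _]; move: le_src; apply/negP; rewrite -ltnNge.
    apply: (@leq_trans y.+1); last by lia.
    rewrite ltnS [leqRHS](divn_eq y (reg s0 14)) leq_add2r leq_mul ?fit.2 //.
    by rewrite [leqRHS](divn_eq (y %/ reg s0 14) (reg s0 13)) leq_add2r leq_mul ?fit.1.
  split=> //=.
  + split=> // x; rewrite !inE !negb_or => /and4P[/negbTE x15 /negbTE x22 /negbTE x23 /negbTE x24].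
    by rewrite /= x15 x22 x23 x24 fr // !inE x15 x22 x23 x24.
  + move=> x; rewrite !inE => /or3P[] /eqP -> /=; rewrite leq_max; apply/orP; right.
    * by rewrite (leq_trans (leq_div _ _)) // (leq_trans (leq_div _ _)) // ltnW.
    * by rewrite (leq_trans (leq_mod _ _)) // (leq_trans (leq_div _ _)) // ltnW.
    * by rewrite (leq_trans (leq_mod _ _)) // ltnW.
  + move=> x /=; rewrite copyE fmE /fm; case: eqVneq => [->|ne].
      by rewrite -yE leqnn lty.
    congr (if _ then _ else _); congr andb; lia.
- exists 0%N => g X s0 bX gX Ps0; rewrite expn1; have [[X2 [sz0 sz1]] rX iX fX] := bX.
  split=> // [|i s lei [fit fr r15 bd fmE]].
    split=> //.
    + exact: Pfit Ps0.
    + by rewrite subn0.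
    + by move=> x _; rewrite leq_maxl.
    + by move=> x; rewrite /fm subn0; case: leqP => // lex; rewrite ltnNge lex.
  split; last by rewrite /= r15 add0n subn_gt0.
  apply: bounded_frame bX fr _ _ => [x|a].
    rewrite inE => /orP[/eqP ->|xl]; first by rewrite r15 (leq_trans (leq_subr _ _)).
    by apply: leq_trans (bd x xl) _; rewrite geq_max !rX.
  by rewrite fmE /fm; case: ifP => // _; rewrite /copied; case: ifP.
- move=> g s0 s Ps0 [fit fr r15 bd fmE]; apply: PQ Ps0 fr _ => x ltx.
  by rewrite fmE /fm subnn ltx.
Qed.

End MainLoop.

(** * The program *)

Lemma eq_runs (f g : nat -> nat) (N : nat) :
  (forall a, (a < N)%N -> f a = g a) -> runs f N = runs g N.
Proof.
move=> fg; congr flatten; apply/eq_in_map => a.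
by rewrite mem_iota add0n => /fg ->.
Qed.

Lemma mem_stamps al be ga c cs x :
  reflect (exists2 t, (t < size cs)%N & x = (al * (c + t) + be * nth 0 cs t + ga)%N)
          (x \in stamps al be ga c cs).
Proof.
elim: cs c => [|a cs IH] c /=; first by apply: (iffP idP) => // -[].
rewrite inE; apply: (iffP orP) => [[/eqP ->|/IH[t ltt ->]]|[[|t] ltt xE]].
- by exists 0%N; rewrite ?addn0.
- by exists t.+1; rewrite ?addnS.
- by left; rewrite xE addn0.
- by right; apply/IH; exists t; rewrite // xE addSnnS.
Qed.

Section Program.
Local Notation "x +! y" := (IAdd x y) (at level 50, left associativity).
Local Notation "x -! y" := (ISub x y) (at level 50, left associativity).
Local Notation "x *! y" := (IMul x y) (at level 40, left associativity).
Local Notation "$ x" := (IReg x) (at level 1, format "$ x").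
Local Notation "# x" := (IConst x) (at level 1, format "# x").
Local Notation "x <- e" := (SetReg x e) (at level 60).
Local Notation "c1 ;; c2" := (Seq c1 c2) (at level 61, right associativity).

Variable F : fieldType.
Implicit Types (s : state F).

Definition block_len : iexp := ILoad ($16 +! $22).
Definition pad_len : iexp := $18 +! ($22 +! #1) -! ILoad ($16 +! $22).
Definition stamp : cmd F := fill F block_len ;; fill F pad_len.

Definition set_dims : cmd F :=
  9 <- $0 *! $3 +! IDiv ($0 *! ($0 +! #1)) #2 ;;
  10 <- $1 *! ($3 +! $4 +! $0) +! IDiv ($1 *! ($1 +! #1)) #2 ;;
  11 <- $2 *! ($5 +! $0 +! $1) +! IDiv ($2 *! ($2 +! #1)) #2 ;;
  12 <- $3 *! ($6 +! $6 *! $7 *! $8) +! $4 *! ($0 +! $7 *! $8) +! $5 *! $8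
        +! $6 +! $1 +! $6 *! $7 *! $8 +! $0 *! $8 -! #2 ;;
  13 <- $3 *! ($6 *! $7) +! $4 *! $7 +! $5 *! $1 +! $0 *! $1 +! $6 *! $7 +! $2 -! #1 ;;
  14 <- $3 *! ($2 *! $6 +! $6 *! $7 *! $8) +! $4 *! ($0 *! $2 +! $7 *! $8)
        +! $5 *! ($8 -! #1) +! ($6 -! #1) *! $2 +! $1 *! $2 +! $6 *! $7 *! $8
        +! $0 *! $8 -! #1 ;;
  15 <- $12 *! $13 *! $14.

(** Registers 19 to 21 receive the coefficients of the affine addresses. With m', l' the last two
    output dimensions, the pairing of U at position x of colour a has address x (m' l' + l') + a +
    |V| l' + |W|, where |V| and |W| are padded dimensions. Registers 0 to 2 are overwritten last, as
    they hold the numbers of blocks until then. *)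
Definition prog : cmd F :=
  (16 <- #0 ;; 17 <- $0) ;; scan F ;;
  (3 <- $18 ;; 6 <- $19 ;; 16 <- $0 ;; 17 <- $1) ;; scan F ;;
  (4 <- $18 ;; 7 <- $19 ;; 16 <- $0 +! $1 ;; 17 <- $2) ;; scan F ;;
  (5 <- $18 ;; 8 <- $19 ;; set_dims) ;; copy F ;;
  (16 <- #0 ;; 17 <- $0 ;; 18 <- $3 ;; 19 <- $13 *! $14 +! $14 ;; 20 <- #1 ;;
   21 <- $10 *! $14 +! $11 ;; 24 <- #0) ;; stamp ;;
  (16 <- $0 ;; 17 <- $1 ;; 18 <- $3 +! $4 +! $0 ;; 19 <- $13 *! $14 +! $14 ;; 20 <- #1 ;;
   21 <- $9 *! $13 *! $14 +! $11 +! $0 ;; 24 <- #0) ;; stamp ;;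
  (16 <- $0 +! $1 ;; 17 <- $2 ;; 18 <- $5 +! $0 +! $1 ;; 19 <- $13 *! $14 +! #1 ;; 20 <- $14 ;;
   21 <- ($9 +! $10) *! $13 *! $14 +! ($10 +! $9) *! $14 ;; 24 <- #0) ;; stamp ;;
  (0 <- $12 ;; 1 <- $13 ;; 2 <- $14).

Variable sz : F -> nat.

Lemma stamp_triple (G : Type) (mu : G -> nat) (P Q : G -> state F -> Prop)
    (bs : G -> seq nat) :
  (forall g s, P g s -> [/\ reg s 17 = size (bs g), reg s 24 = 0%N &
     forall a, (a < size (bs g))%N -> imem s (reg s 16 + a) = nth 0%N (bs g) a]) ->
  (forall g s s', P g s -> frame [:: 22; 23; 24] s s' ->
     fmem s' =1 mark (stamps (reg s 19) (reg s 20) (reg s 21) 0 (colours (reg s 18) (bs g)))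
                  (fmem s) -> Q g s') ->
  triple sz mu P stamp Q.
Proof.
move=> Pbs PQ.
pose mid g s' := exists2 s, P g s & [/\ frame [:: 22; 23; 24] s s',
  reg s' 24 = size (runs (nth 0%N (bs g)) (size (bs g))) &
  fmem s' =1 mark (stamps (reg s 19) (reg s 20) (reg s 21) 0
                      (runs (nth 0%N (bs g)) (size (bs g)))) (fmem s)].
apply: (triple_seq (Q := mid)).
  apply: (@fill_triple _ _ _ (fun im st K a => im (st + a)%N)) => // g s s' Ps fr.
  have [r17 r24 bsE] := Pbs g s Ps; rewrite /stamp_list r24 r17 add0n.
  rewrite (eq_runs (g := nth 0%N (bs g))) // => r24' fm.
  by exists s.
apply: (@fill_triple _ _ _ (fun im st K a => (K + (a + 1) - im (st + a))%N)) => //.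
move=> g s1 s' [s Ps [fr1 r24 fm1]] fr r24' fm.
have [r17 _ bsE] := Pbs g s Ps; have [rg im] := fr1.
apply: (PQ g s) => //; first exact: frame_trans fr1 fr.
move=> x; rewrite fm /stamp_list r24 !rg // r17 stamps_cat mark_cat add0n.
rewrite [X in mark (stamps _ _ _ _ X) (fmem s1)](@eq_runs _
  (fun a => (reg s 18 + a.+1 - nth 0%N (bs g) a)%N)) => [|a lta].
  exact: (eq_mark _ fm1 x).
by rewrite /run_length addn1 im !rg // bsE.
Qed.

(** Packs the dependent input data into one type, the ghost parameter of the triples. *)
Record instance := Instance {
  numU : nat; numV : nat; numW : nat;
  sizesU : 'I_numU -> nat; sizesV : 'I_numV -> nat; sizesW : 'I_numW -> nat;
  source : tensor F (\sum_i sizesU i) (\sum_j sizesV j) (\sum_k sizesW k) }.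

Implicit Type g : instance.

Definition dimU g := (\sum_i @sizesU g i)%N.
Definition dimV g := (\sum_j @sizesV g j)%N.
Definition dimW g := (\sum_k @sizesW g k)%N.
Definition inst_size g := (tensor_size sz (source g) + 2 ^ (numU g + numV g + numW g))%N.
Definition colsU g := colours (dimU g) (block_sizes (@sizesU g)).
Definition colsV g := colours (dimU g + dimV g + numU g) (block_sizes (@sizesV g)).
Definition colsW g := colours (dimW g + numU g + numV g) (block_sizes (@sizesW g)).
Definition out1 g := dim1 (numU g) (numV g) (numW g) (dimU g) (dimV g) (dimW g).
Definition out2 g := dim2 (numU g) (numV g) (numW g) (dimU g) (dimV g) (dimW g).
Definition out3 g := dim3 (numU g) (numV g) (numW g) (dimU g) (dimV g) (dimW g).

Definition env0 g s :=
  [/\ reg s 0 = numU g, reg s 1 = numV g, reg s 2 = numW g &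
      imem s = nth 0%N (block_sizes (@sizesU g) ++ block_sizes (@sizesV g) ++ block_sizes (@sizesW g))].
Definition input g s := fmem s = nth 0 (entries (source g)).

Definition env1 g s :=
  [/\ env0 g s, [/\ reg s 3 = dimU g, reg s 4 = dimV g & reg s 5 = dimW g],
      [/\ reg s 9 = size (colsU g), reg s 10 = size (colsV g) & reg s 11 = size (colsW g)] &
      [/\ reg s 12 = out1 g, reg s 13 = out2 g & reg s 14 = out3 g]].

Definition contents g (h : nat -> F) s :=
  forall x, (x < out1 g * out2 g * out3 g)%N -> fmem s x = h x.

Definition base g x : F :=
  let i := (x %/ out3 g %/ out2 g)%N in
  let j := (x %/ out3 g %% out2 g)%N in
  let k := (x %% out3 g)%N in
  if [&& i < dimU g, j < dimV g & k < dimW g]%N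
  then nth 0 (entries (source g)) ((i * dimV g + j) * dimW g + k) else 0.

Definition withU g := mark (stamps (out2 g * out3 g + out3 g) 1
  (size (colsV g) * out3 g + size (colsW g)) 0 (colsU g)) (base g).
Definition withV g := mark (stamps (out2 g * out3 g + out3 g) 1
  (size (colsU g) * out2 g * out3 g + size (colsW g) + numU g) 0 (colsV g)) (withU g).
Definition withW g := mark (stamps (out2 g * out3 g + 1) (out3 g)
  ((size (colsU g) + size (colsV g)) * out2 g * out3 g + (size (colsV g) + size (colsU g)) * out3 g) 0
  (colsW g)) (withV g).

Lemma seg_p g s : env0 g s -> forall a, (a < numU g)%N ->
  imem s (0 + a) = nth 0%N (block_sizes (@sizesU g)) a.
Proof. by move=> [_ _ _ ->] a lta; rewrite nth_cat size_block_sizes add0n lta. Qed.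

Lemma seg_q g s : env0 g s -> forall a, (a < numV g)%N ->
  imem s (numU g + a) = nth 0%N (block_sizes (@sizesV g)) a.
Proof.
move=> [_ _ _ ->] a lta; rewrite nth_cat size_block_sizes ltnNge leq_addr /= addKn.
by rewrite nth_cat size_block_sizes lta.
Qed.

Lemma seg_r g s : env0 g s -> forall a, (a < numW g)%N ->
  imem s (numU g + numV g + a) = nth 0%N (block_sizes (@sizesW g)) a.
Proof.
move=> [_ _ _ ->] a lta; rewrite -addnA nth_cat size_block_sizes ltnNge leq_addr /= addKn.
by rewrite nth_cat size_block_sizes ltnNge leq_addr /= addKn.
Qed.

Lemma seg_sumE s N (p : 'I_N -> nat) :
  (forall a, (a < N)%N -> imem s (reg s 16 + a) = nth 0%N (block_sizes p) a) ->
  seg_sum s N = (\sum_i p i)%N.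
Proof. by move=> sE; apply: eq_bigr => a _; rewrite sE // nth_block_sizes. Qed.

Lemma exp2_inst_size g : [/\ 2 ^ numU g <= inst_size g, 2 ^ numV g <= inst_size g & 2 ^ numW g <= inst_size g]%N.
Proof. by rewrite /inst_size; split; apply: leq_trans (leq_addl _ _); rewrite leq_pexp2l //; lia. Qed.

Lemma dims_inst_size g : [/\ dimU g <= inst_size g, dimV g <= inst_size g & dimW g <= inst_size g]%N.
Proof. by rewrite /inst_size /tensor_size /dimU /dimV /dimW; split; lia. Qed.

Lemma env0_frame l g s s' : all (fun x => x \notin l) [:: 0; 1; 2]%N ->
  frame l s s' -> env0 g s -> env0 g s'.
Proof.
move=> /and4P[l0 l1 l2 _] [fr im] [r0 r1 r2 imE].
by split; rewrite ?fr ?im.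
Qed.

Lemma env1_frame l g s s' :
  all (fun x => x \notin l) [:: 0; 1; 2; 3; 4; 5; 9; 10; 11; 12; 13; 14]%N ->
  frame l s s' -> env1 g s -> env1 g s'.
Proof.
move=> /allP al fr [e0 [r3 r4 r5] [r9 r10 r11] [r12 r13 r14]].
have fr' x : x \in [:: 0; 1; 2; 3; 4; 5; 9; 10; 11; 12; 13; 14]%N -> reg s' x = reg s x.
  by move=> /al; apply: fr.1.
split; first by apply: env0_frame fr e0; apply/allP => x xl; apply: al; move: xl;
  rewrite !inE => /or3P[] ->; rewrite ?orbT.
all: by split; rewrite fr'.
Qed.

(** The assertions [A1] to [B3] follow the three scans and [C0] the computation of the dimensions.
    [C1 h] says that the output area contains [h], and [D] adds the arguments of [stamp]. *)
Lemma prog_triple :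
  triple sz inst_size (fun g s => env0 g s /\ input g s) prog
    (fun g s => [/\ reg s 0 = out1 g, reg s 1 = out2 g, reg s 2 = out3 g & contents g (withW g) s]).
Proof.
pose A1 g s := [/\ env0 g s, input g s, reg s 16 = 0%N & reg s 17 = numU g].
apply: (triple_seq (Q := A1)).
  apply: triple_loopfree => // g s [[r0 r1 r2 im] inp]; by split; rewrite //= r0.
pose B1 g s := [/\ env0 g s, input g s, reg s 18 = dimU g & reg s 19 = (2 ^ numU g)%N].
apply: (triple_seq (Q := B1)).
  apply: scan_triple => [g s [e0 inp r16 r17]|g s s' [e0 inp r16 r17] fr fm r18 r19].
    rewrite r17 (@seg_sumE _ _ (@sizesU g)) => [|a lta]; last by rewrite r16; apply: seg_p lta.
    by have [-> _ _] := exp2_inst_size g; have [-> _ _] := dims_inst_size g.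
  split; [exact: env0_frame fr e0 | by rewrite /input fm | | by rewrite r19 r17].
  by rewrite r18 r17 (@seg_sumE _ _ (@sizesU g)) // => a lta; rewrite r16; apply: seg_p lta.
pose A2 g s := [/\ env0 g s, input g s, reg s 3 = dimU g /\ reg s 6 = (2 ^ numU g)%N &
  reg s 16 = numU g /\ reg s 17 = numV g].
apply: (triple_seq (Q := A2)).
  apply: triple_loopfree => // g s [[r0 r1 r2 im] inp r18 r19]; by split; rewrite //= ?r0 ?r1 ?r18 ?r19.
pose B2 g s := [/\ env0 g s, input g s, reg s 3 = dimU g /\ reg s 6 = (2 ^ numU g)%N &
  reg s 18 = dimV g /\ reg s 19 = (2 ^ numV g)%N].
apply: (triple_seq (Q := B2)).
  apply: scan_triple => [g s [e0 inp [r3 r6] [r16 r17]]|g s s' [e0 inp [r3 r6] [r16 r17]] fr fm r18 r19].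
    rewrite r17 (@seg_sumE _ _ (@sizesV g)) => [|a lta]; last by rewrite r16; apply: seg_q lta.
    by have [_ -> _] := exp2_inst_size g; have [_ -> _] := dims_inst_size g.
  split; [exact: env0_frame fr e0 | by rewrite /input fm | by rewrite !fr.1 | rewrite r19 r17; split=> //].
  by rewrite r18 r17 (@seg_sumE _ _ (@sizesV g)) // => a lta; rewrite r16; apply: seg_q lta.
pose A3 g s := [/\ env0 g s, input g s, reg s 3 = dimU g /\ reg s 6 = (2 ^ numU g)%N,
  reg s 4 = dimV g /\ reg s 7 = (2 ^ numV g)%N & reg s 16 = (numU g + numV g)%N /\ reg s 17 = numW g].
apply: (triple_seq (Q := A3)).
  apply: triple_loopfree => // g s [[r0 r1 r2 im] inp [r3 r6] [r18 r19]].
  by split; rewrite //= ?r0 ?r1 ?r2 ?r18 ?r19.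
pose B3 g s := [/\ env0 g s, input g s, reg s 3 = dimU g /\ reg s 6 = (2 ^ numU g)%N,
  reg s 4 = dimV g /\ reg s 7 = (2 ^ numV g)%N & reg s 18 = dimW g /\ reg s 19 = (2 ^ numW g)%N].
apply: (triple_seq (Q := B3)).
  apply: scan_triple => [g s [e0 inp _ _ [r16 r17]]|g s s' [e0 inp [r3 r6] [r4 r7] [r16 r17]] fr fm r18 r19].
    rewrite r17 (@seg_sumE _ _ (@sizesW g)) => [|a lta]; last by rewrite r16; apply: seg_r lta.
    by have [_ _ ->] := exp2_inst_size g; have [_ _ ->] := dims_inst_size g.
  split; [exact: env0_frame fr e0 | by rewrite /input fm | by rewrite !fr.1 | by rewrite !fr.1 |
    rewrite r19 r17; split=> //].
  by rewrite r18 r17 (@seg_sumE _ _ (@sizesW g)) // => a lta; rewrite r16; apply: seg_r lta.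
pose C0 g s := [/\ env1 g s, input g s & reg s 15 = (out1 g * out2 g * out3 g)%N].
apply: (triple_seq (Q := C0)).
  apply: triple_loopfree => // g s [[r0 r1 r2 im] inp [r3 r6] [r4 r7] [r18 r19]].
  split=> //; last first.
    by rewrite /= ?r0 ?r1 ?r2 ?r3 ?r4 ?r6 ?r7 ?r18 ?r19 /out1 /out2 /out3 /dim1 /dim2 /dim3 !expnD.
  split=> //; split; rewrite //= ?r0 ?r1 ?r2 ?r3 ?r4 ?r6 ?r7 ?r18 ?r19 ?addn1.
  + by rewrite /colsU size_sU.
  + by rewrite /colsV size_sV.
  + by rewrite /colsW size_sW.
  + by rewrite /out1 /dim1 !expnD.
  + by rewrite /out2 /dim2 !expnD.
  + by rewrite /out3 /dim3 !expnD.
pose C1 h g s := env1 g s /\ contents g (h g) s.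
apply: (triple_seq (Q := C1 base)).
  (* The input radices are at most the output radices because the padded spaces fit. *)
  apply: copy_triple => [g s [[_ [_ -> ->] _ [_ -> ->]] _ _]|g s s' [e1 inp r15] fr fm].
    split.
      apply: leq_trans (fitV (@sizesU g) (@sizesV g) (@sizesW g)); rewrite -addnA.
      exact: leq_trans (le_size_colours _ (@sizesV g)) (leq_addr _ _).
    apply: leq_trans (fitW (@sizesU g) (@sizesV g) (@sizesW g)); rewrite -addnA.
    exact: leq_trans (le_size_colours _ (@sizesW g)) (leq_addr _ _).
  split; first exact: env1_frame fr e1.
  move=> x; rewrite -r15 => ltx; rewrite fm // /copied inp.
  by have [_ [-> -> ->] _ [_ -> ->]] := e1.
pose D h st cnt K al be ga g s := [/\ C1 h g s, [/\ reg s 16 = st g, reg s 17 = cnt g & reg s 18 = K g],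
  [/\ reg s 19 = al g, reg s 20 = be g & reg s 21 = ga g] & reg s 24 = 0%N].
have stampE h st K al be ga (bs : instance -> seq nat) :
    (forall g s, env0 g s -> forall a, (a < size (bs g))%N -> imem s (st g + a) = nth 0%N (bs g) a) ->
    triple sz inst_size (D h st (fun g => size (bs g)) K al be ga) stamp
      (C1 (fun g => mark (stamps (al g) (be g) (ga g) 0 (colours (K g) (bs g))) (h g))).
  move=> seg; apply: (@stamp_triple _ _ _ _ bs) => [g s [[e1 _] [r16 r17 _] _ r24]|
      g s s' [[e1 ct] [r16 r17 r18] [r19 r20 r21] r24] fr fm].
    by split=> // a lta; rewrite r16 (seg g s) //; case: e1.
  split; first exact: env1_frame fr e1.
  by move=> x ltx; rewrite fm r18 r19 r20 r21 /mark ct.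
have asgE h st cnt K al be ga c : loopfree c ->
    (forall g s, env1 g s -> fmem (run c s) = fmem s /\ frame [:: 16; 17; 18; 19; 20; 21; 24] s (run c s) /\
      [/\ [/\ reg (run c s) 16 = st g, reg (run c s) 17 = cnt g & reg (run c s) 18 = K g],
       [/\ reg (run c s) 19 = al g, reg (run c s) 20 = be g & reg (run c s) 21 = ga g] &
       reg (run c s) 24 = 0%N]) ->
    triple sz inst_size (C1 h) c (D h st cnt K al be ga).
  move=> lf H; apply: triple_loopfree => // g s [e1 ct].
  have [fm [fr [r1 r2 r3]]] := H g s e1; split=> //.
  split; first exact: env1_frame fr e1.
  by move=> x ltx; rewrite fm ct.
have frameE s s' : (forall x, x \notin [:: 16; 17; 18; 19; 20; 21; 24] -> reg s' x = reg s x) ->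
    imem s' = imem s -> frame [:: 16; 17; 18; 19; 20; 21; 24] s s' by [].
apply: (triple_seq (Q := D base (fun=> 0%N) (fun g => size (block_sizes (@sizesU g))) dimU
    (fun g => out2 g * out3 g + out3 g)%N (fun=> 1%N)
    (fun g => size (colsV g) * out3 g + size (colsW g))%N)).
  apply: asgE => // g s [[r0 r1 r2 im] [r3 r4 r5] [r9 r10 r11] [r12 r13 r14]].
  split=> //; split.
    apply: frameE => // x; rewrite !inE !negb_or => /and5P[x16 x17 x18 x19 /and3P[x20 x21 x24]] /=.
    by rewrite !ifN.
  by split=> //; split=> //=; rewrite ?size_block_sizes ?r0 ?r3 ?r13 ?r14 ?r10 ?r11.
apply: (triple_seq (Q := C1 withU)).
  by apply: stampE => g s e0 a; rewrite size_block_sizes; apply: seg_p.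
apply: (triple_seq (Q := D withU numU (fun g => size (block_sizes (@sizesV g)))
    (fun g => dimU g + dimV g + numU g)%N (fun g => out2 g * out3 g + out3 g)%N (fun=> 1%N)
    (fun g => size (colsU g) * out2 g * out3 g + size (colsW g) + numU g)%N)).
  apply: asgE => // g s [[r0 r1 r2 im] [r3 r4 r5] [r9 r10 r11] [r12 r13 r14]].
  split=> //; split.
    apply: frameE => // x; rewrite !inE !negb_or => /and5P[x16 x17 x18 x19 /and3P[x20 x21 x24]] /=.
    by rewrite !ifN.
  by split=> //; split=> //=; rewrite ?size_block_sizes ?r0 ?r1 ?r3 ?r4 ?r13 ?r14 ?r9 ?r11.
apply: (triple_seq (Q := C1 withV)).
  by apply: stampE => g s e0 a; rewrite size_block_sizes; apply: seg_q.
apply: (triple_seq (Q := D withV (fun g => numU g + numV g)%N (fun g => size (block_sizes (@sizesW g)))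
    (fun g => dimW g + numU g + numV g)%N (fun g => out2 g * out3 g + 1)%N out3
    (fun g => (size (colsU g) + size (colsV g)) * out2 g * out3 g +
              (size (colsV g) + size (colsU g)) * out3 g)%N)).
  apply: asgE => // g s [[r0 r1 r2 im] [r3 r4 r5] [r9 r10 r11] [r12 r13 r14]].
  split=> //; split.
    apply: frameE => // x; rewrite !inE !negb_or => /and5P[x16 x17 x18 x19 /and3P[x20 x21 x24]] /=.
    by rewrite !ifN.
  by split=> //; split=> //=; rewrite ?size_block_sizes ?r0 ?r1 ?r2 ?r5 ?r13 ?r14 ?r9 ?r10.
apply: (triple_seq (Q := C1 withW)).
  by apply: stampE => g s e0 a; rewrite size_block_sizes; apply: seg_r.
apply: triple_loopfree => // g s [[_ _ _ [r12 r13 r14]] ct].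
by split=> //=; rewrite ?r12 ?r13 ?r14.
Qed.

End Program.

(** * Output and running time of the program *)

Section Correctness.
Variables (F : fieldType).
Implicit Type g : instance F.

Lemma baseE g (i : 'I_(out1 g)) (j : 'I_(out2 g)) (k : 'I_(out3 g)) :
  base g ((i * out2 g + j) * out3 g + k) = tensor_get (source g) i j k.
Proof.
have [iE jE kE] := radix3_div i (ltn_ord j) (ltn_ord k).
rewrite /base iE jE kE /tensor_get.
case: insubP => [i' -> <-|/negbTE -> //]; case: insubP => [j' -> <-|/negbTE -> //].
by case: insubP => [k' -> <-|/negbTE -> //]; rewrite nth_entries.
Qed.

(** A flat address determines its coordinates, so membership in each list of stamps becomes one
    clause of [stamped]. All lists write ones, so their order is immaterial. *)
Lemma withWE g (i : 'I_(out1 g)) (j : 'I_(out2 g)) (k : 'I_(out3 g)) :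
  withW g ((i * out2 g + j) * out3 g + k) = reduction (source g) (i, j, k).
Proof.
have fit2 : (size (colsV g) + size (colsU g) + numW g <= out2 g)%N by apply: fitV.
have fit3 : (size (colsW g) + numU g + numV g <= out3 g)%N by apply: fitW.
have ltU t : (t < size (colsU g))%N -> (nth 0 (colsU g) t < numU g)%N.
  by move=> /nth_colours_lt; rewrite size_block_sizes.
have ltV t : (t < size (colsV g))%N -> (nth 0 (colsV g) t < numV g)%N.
  by move=> /nth_colours_lt; rewrite size_block_sizes.
have ltW t : (t < size (colsW g))%N -> (nth 0 (colsW g) t < numW g)%N.
  by move=> /nth_colours_lt; rewrite size_block_sizes.
have inj := radix3_inj (ltn_ord j) (ltn_ord k).
rewrite /withW /withV /withU /mark baseE [RHS]ffunE /stamped /= -/(colsU g) -/(colsV g) -/(colsW g).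
set bU := _ \in stamps _ _ _ _ (colsU g); set bV := _ \in stamps _ _ _ _ (colsV g).
set bW := _ \in stamps _ _ _ _ (colsW g).
have -> : bU = [&& i < size (colsU g), j == size (colsV g) + i :> nat &
                   k == size (colsW g) + nth 0 (colsU g) i :> nat]%N.
  apply/mem_stamps/and3P => [[t ltt e]|[lti /eqP jE /eqP kE]].
    have := ltU t ltt => ltc.
    have [|||iE jE kE] := inj i t (size (colsV g) + t)%N (size (colsW g) + nth 0 (colsU g) t)%N.
    - by lia.
    - by lia.
    - by rewrite e; lia.
    by rewrite iE jE kE !eqxx.
  by exists i => //; rewrite jE kE; lia.
have -> : bV = [&& j < size (colsV g), i == size (colsU g) + j :> nat &
                   k == size (colsW g) + numU g + nth 0 (colsV g) j :> nat]%N.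
  apply/mem_stamps/and3P => [[t ltt e]|[lti /eqP iE /eqP kE]].
    have := ltV t ltt => ltc.
    have [|||iE jE kE] := inj i (size (colsU g) + t)%N t (size (colsW g) + numU g + nth 0 (colsV g) t)%N.
    - by lia.
    - by lia.
    - by rewrite e; lia.
    by rewrite jE iE kE !eqxx.
  by exists j => //; rewrite iE kE; lia.
have -> : bW = [&& k < size (colsW g), i == size (colsU g) + size (colsV g) + k :> nat &
                   j == size (colsV g) + size (colsU g) + nth 0 (colsW g) k :> nat]%N.
  apply/mem_stamps/and3P => [[t ltt e]|[lti /eqP iE /eqP jE]].
    have := ltW t ltt => ltc.
    have [|||iE jE kE] := inj i (size (colsU g) + size (colsV g) + t)%N
      (size (colsV g) + size (colsU g) + nth 0 (colsW g) t)%N t.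
    - by lia.
    - by lia.
    - by rewrite e; lia.
    by rewrite kE iE jE !eqxx.
  by exists k => //; rewrite iE jE; lia.
by do 3!case: [&& _, _ & _].
Qed.

Lemma bounded_input (sz : F -> nat) g :
  bounded sz (inst_size sz g + sz 0 + sz 1 + 2)
    (input_state (source g)).
Proof.
have [leN leM leL] := exp2_inst_size sz g.
have [len lem lel] := dims_inst_size sz g.
have ltn_2 n := ltn_expl n (isT : (1 < 2)%N).
split=> [|x|a|a] /=.
- by lia.
- case: x => [|[|[|x]]] /=; last by rewrite nth_nil.
  + by have := ltn_2 (numU g); lia.
  + by have := ltn_2 (numV g); lia.
  + by have := ltn_2 (numW g); lia.
- apply: (@leq_trans (inst_size sz g)); last by lia.
  rewrite !nth_cat !size_block_sizes; case: ifP => _; first exact: leq_trans (nth_block_sizes_le _ _) len.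
  case: ifP => _; first exact: leq_trans (nth_block_sizes_le _ _) lem.
  exact: leq_trans (nth_block_sizes_le _ _) lel.
case: (ltnP a (size (entries (source g)))) => [lta|lea]; last by rewrite nth_default //; lia.
have /allpairsP[[ij k] /= [_ _ ->]] := mem_nth 0 lta.
apply: (@leq_trans (inst_size sz g)); last by lia.
by rewrite /inst_size /tensor_size (bigD1 (ij, k)) //=; lia.
Qed.

Lemma reduction_poly_time : poly_time (reduction (F := F)).
Proof.
exists (prog F) => sz; have [k H] := prog_triple sz.
(* For an instance of size S the initial bound is S + sz 0 + sz 1 + 2, at most (sz 0 + sz 1 + 3) S
   because S >= 1. *)
exists ((sz 0%R + sz 1%R + 3) ^ k.+1)%N, k.+1 => N M L p q r A _ _ _.
pose g := Instance A.
have [||s [t [ex le [[r0 r1 r2 ct] _]]]] :=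
  H g _ (input_state A) (bounded_input sz g).
- by lia.
- by split.
exists s, t; split=> //.
  split=> //; apply/esym/entries_mkseq => i j k'.
  by rewrite ct ?radix3_lt // (withWE (g := g) i j k').
apply: leq_trans le _; rewrite -expnMn leq_exp2r //.
have : (0 < inst_size sz g)%N by rewrite addn_gt0 expn_gt0 orbT.
by rewrite -/(inst_size sz g) /=; nia.
Qed.

End Correctness.

(** * Linear size for boundedly many blocks *)

Lemma dims_linear (b : nat) : exists C : nat,
  forall N M L n m l : nat, (N <= n)%N -> (M <= m)%N -> (L <= l)%N ->
    (N <= b)%N -> (M <= b)%N -> (L <= b)%N ->
    [/\ dim1 N M L n m l <= C * (n + m + l), dim2 N M L n m l <= C * (n + m + l) &
        dim3 N M L n m l <= C * (n + m + l)]%N.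
Proof.
(* The coefficients of [n], [m], [l] are at most [2 * T]. At most four positive terms remain, each
   at most [T] and hence at most [T * (n + m + l)] when there are coordinates. *)
set B := (2 ^ b)%N; pose T := (B * B * B)%N; exists (8 * T)%N => N M L n m l Nn Mm Ll Nb Mb Lb.
case: (posnP (n + m + l)) => [sum0|sum_gt0].
  (* Without coordinates there are no blocks, and the constants cancel: all three dimensions are
     0. *)
  have [n0 m0 l0] : [/\ n = 0, m = 0 & l = 0]%N by split; lia.
  have [N0 M0 L0] : [/\ N = 0, M = 0 & L = 0]%N by split; lia.
  by subst.
have B_gt0 : (0 < B)%N by rewrite expn_gt0.
have bB : (b < B)%N by apply: ltn_expl.
have BB_T : (B * B <= T)%N by rewrite /T leq_pmulr.
have B_T : (B <= T)%N by apply: leq_trans BB_T; rewrite leq_pmulr.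
have leT a c d : (a <= B)%N -> (c <= B)%N -> (d <= B)%N -> (a * c * d <= T)%N.
  by move=> aB cB dB; rewrite /T !leq_mul.
have leT2 a c : (a <= B)%N -> (c <= B)%N -> (a * c <= T)%N.
  by move=> aB cB; apply: leq_trans BB_T; rewrite leq_mul.
have NB : (2 ^ N <= B)%N by rewrite leq_pexp2l.
have MB : (2 ^ M <= B)%N by rewrite leq_pexp2l.
have LB : (2 ^ L <= B)%N by rewrite leq_pexp2l.
have N_B : (N <= B)%N by lia.
have M_B : (M <= B)%N by lia.
have L_B : (L <= B)%N by lia.
have xyz := leT _ _ _ NB MB LB; have xy := leT2 _ _ NB MB; have yz := leT2 _ _ MB LB.
have Lx := leT2 _ _ L_B NB; have NL := leT2 _ _ N_B L_B; have Nz := leT2 _ _ N_B LB.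
have NM := leT2 _ _ N_B M_B; have ML := leT2 _ _ M_B L_B.
have xL : ((2 ^ N - 1) * L <= T)%N by apply: leT2 => //; lia.
have Ts : (T <= T * (n + m + l))%N by rewrite leq_pmulr.
have coef k c : (c <= 2 * T)%N -> (k * c <= k * (2 * T))%N by move=> ck; rewrite leq_mul.
rewrite /dim1 /dim2 /dim3 !expnD; split.
- have := coef n (2 ^ N + 2 ^ N * 2 ^ M * 2 ^ L)%N; have := coef m (N + 2 ^ M * 2 ^ L)%N.
  have := coef l (2 ^ L)%N; lia.
- have := coef n (2 ^ N * 2 ^ M)%N; have := coef m (2 ^ M)%N; have := coef l M; lia.
- have := coef n (L * 2 ^ N + 2 ^ N * 2 ^ M * 2 ^ L)%N.
  have := coef m (N * L + 2 ^ M * 2 ^ L)%N; have := coef l (2 ^ L - 1)%N; lia.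
Qed.

Lemma leq_num_blocks (N : nat) (p : 'I_N -> nat) :
  (forall i, 0 < p i)%N -> (N <= \sum_i p i)%N.
Proof.
by move=> p_gt0; rewrite -[leqLHS]card_ord -sum1_card leq_sum.
Qed.

Theorem theorem5p1 (F : fieldType) :
  (exists f : block_map F,
     poly_time f /\
     forall (N M L : nat) (p : 'I_N -> nat) (q : 'I_M -> nat) (r : 'I_L -> nat)
       (A B : tensor F (\sum_i p i) (\sum_j q j) (\sum_k r k)),
       (forall i, 0 < p i)%N -> (forall j, 0 < q j)%N -> (forall k, 0 < r k)%N ->
       part_tensor_iso A B <->
       tensor_iso (f N M L p q r A) (f N M L p q r B)) /\
  (forall b : nat, exists C : nat,
     forall (N M L : nat) (p : 'I_N -> nat) (q : 'I_M -> nat) (r : 'I_L -> nat),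
       (forall i, 0 < p i)%N -> (forall j, 0 < q j)%N -> (forall k, 0 < r k)%N ->
       (N <= b)%N -> (M <= b)%N -> (L <= b)%N ->
       let n := (\sum_i p i)%N in
       let m := (\sum_j q j)%N in
       let l := (\sum_k r k)%N in
       [/\ (dim1 N M L n m l <= C * (n + m + l))%N,
           (dim2 N M L n m l <= C * (n + m + l))%N
         & (dim3 N M L n m l <= C * (n + m + l))%N]).
Proof.
split.
  exists (reduction (F := F)); split; first exact: reduction_poly_time.
  by move=> N M L p q r A B _ _ _; apply: reduction_iso.
move=> b; have [C H] := dims_linear b; exists C => N M L p q r p_gt0 q_gt0 r_gt0 Nb Mb Lb.
by apply: H => //; apply: leq_num_blocks.
Qed.
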